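(* Let $\alpha:\mathbb{R}\to\mathbb{R}^2\equiv\{x_3=0\}\subset\mathbb{R}^3$ be a smooth, $L$-periodic, arc-length parametrized curve whose trace $C$ is a simple closed curve of length $L$, traversed counterclockwise, and let $\Omega$ be the bounded domain enclosed by $C$, with area $|\Omega|$. For $l>0$ let $M$ be the cylindrical column $x(t,s)=\alpha(s)+tE_3$, $t\in[0,l]$, $s\in[0,L]$, oriented by the Gauss map $N(t,s)=E_3\wedge\alpha'(s)$. Suppose $M$ is a rotating stationary surface, i.e. its mean curvature satisfies $2H=a(x_1^2+x_2^2)+b$ on $M$ for constants $a,b\in\mathbb{R}$ (equivalently, the curvature $\kappa$ of $\alpha$ satisfies $\kappa(s)=a|\alpha(s)|^2+b$). If $a>0$ and $M$ is stable, then $$l\le \frac{\pi}{2}\sqrt{\frac{L}{a|\Omega|}}.$$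
   Context: $E_1,E_2,E_3$ is the standard basis of $\mathbb{R}^3$, $\wedge$ the cross product. The curvature $\kappa$ of $\alpha$ is defined by $\alpha''=\kappa\,\mathbf{n}$ with $\mathbf{n}=J\alpha'$, $J$ the counterclockwise rotation by $\pi/2$ in the $x_1x_2$-plane (so $N=\mathbf{n}$ and $2H=\kappa$). For a surface $M$ with Gauss map $N$, second fundamental form $\sigma$, Laplace–Beltrami operator $\Delta$, support function $h=\langle N,x\rangle$, $N_3=\langle N,E_3\rangle$, $x_3=\langle x,E_3\rangle$, satisfying $2H=a(x_1^2+x_2^2)+b$, stability means: $\Phi(u):=-\int_M u\big(\Delta u+(|\sigma|^2-2a(h-x_3N_3))u\big)\,dM\ge 0$ for every smooth $u$ on $M$ vanishing on the boundary $\partial M$ (here: on $t=0$ and $t=l$, and $L$-periodic in $s$) with $\int_M u\,dM=0$. For the column, $\Delta=\partial_t^2+\partial_s^2$, $|\sigma|^2=\kappa(s)^2$ and $h-x_3N_3=-\langle\alpha(s)\wedge\alpha'(s),E_3\rangle$. *)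

(* Defs.v *)
From Stdlib Require Import Reals Lra List ClassicalEpsilon.
Open Scope R_scope.

(* The derivative of f at x (the unique l with derivable_pt_lim f x l when
   f is differentiable at x; an unspecified value otherwise). *)
Definition Der (f : R -> R) (x : R) : R :=
  epsilon (inhabits 0) (fun l => derivable_pt_lim f x l).

Fixpoint nDer (n : nat) (f : R -> R) : R -> R :=
  match n with O => f | S m => Der (nDer m f) end.

Definition smooth (f : R -> R) : Prop :=
  forall n x, derivable_pt_lim (nDer n f) x (nDer (S n) f x).

(* Riemann integral of f over [a,b] (0 if f is not Riemann integrable). *)
Definition RInt (f : R -> R) (a b : R) : R :=
  match excluded_middle_informative (inhabited (Riemann_integrable f a b)) with
  | left H => RiemannInt (epsilon H (fun _ => True))
  | right _ => 0
  end.

Definition Dt (u : R -> R -> R) : R -> R -> R := fun t s => Der (fun t' => u t' s) t.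
Definition Ds (u : R -> R -> R) : R -> R -> R := fun t s => Der (fun s' => u t s') s.

Fixpoint pder (w : list bool) (u : R -> R -> R) : R -> R -> R :=
  match w with
  | nil => u
  | b :: w' => (if b then Dt else Ds) (pder w' u)
  end.

Definition continuous2 (f : R -> R -> R) : Prop :=
  forall t s eps, 0 < eps -> exists del, 0 < del /\
    forall t' s', Rabs (t' - t) < del -> Rabs (s' - s) < del ->
      Rabs (f t' s' - f t s) < eps.

Definition smooth2 (u : R -> R -> R) : Prop :=
  forall w, continuous2 (pder w u) /\
    forall t s,
      derivable_pt_lim (fun t' => pder w u t' s) t (pder (true :: w) u t s) /\
      derivable_pt_lim (fun s' => pder w u t s') s (pder (false :: w) u t s).

Definition Lap (u : R -> R -> R) : R -> R -> R :=
  fun t s => Dt (Dt u) t s + Ds (Ds u) t s.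

Record V3 := mkV3 { vx : R; vy : R; vz : R }.
Definition dot3 (u v : V3) : R := vx u * vx v + vy u * vy v + vz u * vz v.
Definition cross (u v : V3) : V3 :=
  mkV3 (vy u * vz v - vz u * vy v) (vz u * vx v - vx u * vz v) (vx u * vy v - vy u * vx v).
Definition E3 : V3 := mkV3 0 0 1.

(* curvature: alpha'' = kappa n with n = J alpha', J = rotation by +pi/2 *)
Definition kappa (a1 a2 : R -> R) (s : R) : R :=
  nDer 2 a1 s * (- Der a2 s) + nDer 2 a2 s * Der a1 s.

Definition alpha' (a1 a2 : R -> R) (s : R) : V3 := mkV3 (Der a1 s) (Der a2 s) 0.

Definition xM (a1 a2 : R -> R) (t s : R) : V3 := mkV3 (a1 s) (a2 s) t.
Definition NM (a1 a2 : R -> R) (t s : R) : V3 := cross E3 (alpha' a1 a2 s).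
Definition hM (a1 a2 : R -> R) (t s : R) : R := dot3 (NM a1 a2 t s) (xM a1 a2 t s).
Definition N3 (a1 a2 : R -> R) (t s : R) : R := dot3 (NM a1 a2 t s) E3.
Definition x3 (a1 a2 : R -> R) (t s : R) : R := dot3 (xM a1 a2 t s) E3.
(* For the column, |sigma|^2 = kappa^2 and 2H = kappa (N = n). *)
Definition sigma2 (a1 a2 : R -> R) (t s : R) : R := kappa a1 a2 s ^ 2.
Definition twoH (a1 a2 : R -> R) (t s : R) : R := kappa a1 a2 s.

(* integral over M with dM = dt ds, t in [0,l], s in [0,L] *)
Definition IntM (L l : R) (f : R -> R -> R) : R :=
  RInt (fun s => RInt (fun t => f t s) 0 l) 0 L.

Definition Phi (a1 a2 : R -> R) (L l a : R) (u : R -> R -> R) : R :=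
  - IntM L l (fun t s =>
      u t s * (Lap u t s
               + (sigma2 a1 a2 t s
                  - 2 * a * (hM a1 a2 t s - x3 a1 a2 t s * N3 a1 a2 t s)) * u t s)).

Definition stable (a1 a2 : R -> R) (L l a : R) : Prop :=
  forall u : R -> R -> R,
    smooth2 u ->
    (forall t s, u t (s + L) = u t s) ->
    (forall s, u 0 s = 0 /\ u l s = 0) ->
    IntM L l u = 0 ->
    Phi a1 a2 L l a u >= 0.

Definition onC (a1 a2 : R -> R) (p : R * R) : Prop :=
  exists s, p = (a1 s, a2 s).

(* p lies in the bounded domain enclosed by C: p is not on C and its
   (path-)component in R^2 \ C is bounded. *)
Definition inside (a1 a2 : R -> R) (p : R * R) : Prop :=
  ~ onC a1 a2 p /\
  exists Rb, forall g1 g2 : R -> R,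
    (forall tau, continuity_pt g1 tau) -> (forall tau, continuity_pt g2 tau) ->
    (g1 0, g2 0) = p ->
    (forall tau, 0 <= tau <= 1 -> ~ onC a1 a2 (g1 tau, g2 tau)) ->
    forall tau, 0 <= tau <= 1 -> g1 tau ^ 2 + g2 tau ^ 2 <= Rb ^ 2.

(* rectangles [x0,x1] x [y0,y1] *)
Definition rect := (R * R * R * R)%type.
Definition rect_ok (Om : R * R -> Prop) (r : rect) : Prop :=
  let '(x0, x1, y0, y1) := r in
  x0 < x1 /\ y0 < y1 /\
  forall x y, x0 <= x <= x1 -> y0 <= y <= y1 -> Om (x, y).
Definition rect_area (r : rect) : R :=
  let '(x0, x1, y0, y1) := r in (x1 - x0) * (y1 - y0).
Definition rect_disj (r r' : rect) : Prop :=
  let '(x0, x1, y0, y1) := r in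
  let '(x0', x1', y0', y1') := r' in
  x1 <= x0' \/ x1' <= x0 \/ y1 <= y0' \/ y1' <= y0.
Fixpoint rects_disj (rs : list rect) : Prop :=
  match rs with
  | nil => True
  | r :: rs' => Forall (rect_disj r) rs' /\ rects_disj rs'
  end.

(* Area (= inner Jordan content = Lebesgue measure for open sets): the
   supremum of total areas of finitely many interior-disjoint rectangles
   contained in Om. *)
Definition is_area (Om : R * R -> Prop) (A : R) : Prop :=
  is_lub (fun r => exists rs : list rect,
            Forall (rect_ok Om) rs /\ rects_disj rs /\
            r = fold_right (fun q acc => rect_area q + acc) 0 rs) A.

(* Main.v *)
(** Write [alpha = (a1, a2)], [n = J alpha'] and [w = a1 a2' - a2 a1'].  The functions
    [u_i (t, s) = sin (pi t / l) <alpha' s, E_i>], [i = 1, 2], are admissible, and since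
    [<alpha', alpha'''> = - kappa^2] the curvature cancels from the sum of their second
    variations: [Phi u_1 + Phi u_2 = (l / 2) (pi^2 L / l^2 - 2 a int w)].  Stability thus gives
    [2 a int w <= pi^2 L / l^2], and it remains to see that [0 < 2 |Omega| <= int w].

    For the area inequality, let [W p] be the winding number of the curve around [p], mollified
    at a small scale [d].  Its gradient is [int psi (a1 - p1) psi (a2 - p2) n ds], so that [W] is
    locally constant at distance [2 d] from the curve and nondecreasing when the curve is
    crossed along [n].  It is [0] below a lowest point of the curve and [1] just above it.
    Following the two curves parallel to [alpha], and the normal from a nearest point
    of [alpha] elsewhere, one gets [0 <= W] everywhere and [W = 1] at the enclosed points away
    from the curve.  The integral of [W] over a large square, which is [(1 / 2) int w], therefore
    bounds the total area of disjoint rectangles contained in [Omega]. *)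

Require Import Defs.
From Stdlib Require Import Reals ZArith Lra Lia Psatz List ClassicalEpsilon FunctionalExtensionality.
From Coquelicot Require Import Coquelicot.
Open Scope R_scope.

(** The obstacle is that [inside] only records a bounded path component: neither the number of
    components of the complement nor the regularity of the enclosed domain is presupposed. For a
    regular domain Green's formula would identify [W] with the mollified indicator of [Omega]. As
    [|Omega|] is a supremum over finite families of rectangles, it is enough that [W] dominates the
    indicator of each family. The integral of [W] over a large square does not depend on [d], so [d]
    may be chosen after the family and no limit [d -> 0] is taken. Mollifying makes [W]
    differentiable along paths, so that local constancy and monotonicity both come from the mean
    value theorem. As for the test functions, the [<alpha', E_i>] are, up to sign and order, the
    horizontal components of the Gauss map, that is, the normal parts of horizontal translations.
    The sine factor makes them vanish at both ends, and periodicity of [alpha] gives them mean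
    zero. *)

(** * Derivatives, integrals and smooth product functions *)

Lemma Der_unique (f : R -> R) (x y : R) : is_derive f x y -> Der f x = y.
Proof.
  intros H%is_derive_Reals.
  apply (uniqueness_limite f x); [| exact H].
  unfold Der. apply epsilon_spec. now exists y.
Qed.

Lemma RInt_Defs_unique (f : R -> R) (a b v : R) :
  is_RInt f a b v -> Defs.RInt f a b = v.
Proof.
  intros H. unfold Defs.RInt.
  destruct (excluded_middle_informative (inhabited (Riemann_integrable f a b)))
    as [i | n].
  - rewrite <- RInt_Reals. now apply is_RInt_unique.
  - exfalso. apply n. constructor. apply ex_RInt_Reals_0. now exists v.
Qed.

Lemma smooth_is_derive (f : R -> R) (n : nat) (x : R) :
  smooth f -> is_derive (nDer n f) x (nDer (S n) f x).
Proof. intros H. apply is_derive_Reals, H. Qed.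

Lemma nDer_Der (n : nat) (f : R -> R) : nDer n (Der f) = nDer (S n) f.
Proof. induction n as [| n IH]; [reflexivity |]. simpl in *. now rewrite IH. Qed.

Lemma smooth_Der (f : R -> R) : smooth f -> smooth (Der f).
Proof. intros H n x. rewrite !nDer_Der. apply H. Qed.

Lemma is_derive_continuity_pt (f : R -> R) (x y : R) :
  is_derive f x y -> continuity_pt f x.
Proof.
  intros H. apply continuity_pt_filterlim.
  apply (ex_derive_continuous f). now exists y.
Qed.

Lemma is_derive_mult_const_r (f : R -> R) (c x y : R) :
  is_derive f x y -> is_derive (fun t => f t * c) x (y * c).
Proof. exact (is_derive_scal_l f x y c). Qed.

Lemma nDer_sin (w : R) (n : nat) :
  nDer n (fun t => sin (w * t)) = fun t => w ^ n * sin (w * t + INR n * (PI / 2)).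
Proof.
  induction n as [| n IH]; apply functional_extensionality; intros t.
  - simpl. rewrite Rmult_0_l, Rplus_0_r. ring.
  - change (Der (nDer n (fun t => sin (w * t))) t
            = w ^ S n * sin (w * t + INR (S n) * (PI / 2))).
    rewrite IH. apply Der_unique.
    replace (w * t + INR (S n) * (PI / 2))
      with (PI / 2 + (w * t + INR n * (PI / 2))) by (rewrite S_INR; ring).
    rewrite <- cos_sin. auto_derive; [exact I | simpl; ring].
Qed.

Lemma smooth_sin (w : R) : smooth (fun t => sin (w * t)).
Proof.
  intros n x. apply is_derive_Reals.
  assert (E := nDer_sin w (S n)). rewrite E, (nDer_sin w n).
  replace (w * x + INR (S n) * (PI / 2))
    with (PI / 2 + (w * x + INR n * (PI / 2))) by (rewrite S_INR; ring).
  rewrite <- cos_sin. auto_derive; [exact I | simpl; ring].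
Qed.

(** Each [Dt] acts on the first factor and each [Ds] on the second, so only the two letter counts of
    the word matter. This reduces smoothness in two variables to smoothness in one. *)
Lemma pder_prod (f g : R -> R) (w : list bool) : smooth f -> smooth g ->
  pder w (fun t s => f t * g s) =
  fun t s => nDer (length (filter (fun b => b) w)) f t
             * nDer (length (filter negb w)) g s.
Proof.
  intros Hf Hg. induction w as [| b w IH]; [reflexivity |].
  simpl pder. rewrite IH.
  apply functional_extensionality; intros t.
  apply functional_extensionality; intros s.
  destruct b; simpl length; apply Der_unique.
  - apply is_derive_mult_const_r. now apply smooth_is_derive.
  - apply (is_derive_scal (nDer _ g)). now apply smooth_is_derive.
Qed.

Lemma smooth2_prod (f g : R -> R) :
  smooth f -> smooth g -> smooth2 (fun t s => f t * g s).
Proof.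
  intros Hf Hg w. split.
  - rewrite pder_prod by assumption. intros t s eps Heps.
    set (F := nDer _ f). set (G := nDer _ g).
    assert (HC : continuity_2d_pt (fun t s => F t * G s) t s).
    { apply continuity_2d_pt_mult.
      - apply (continuity_1d_2d_pt_comp F (fun t _ => t)).
        + eapply is_derive_continuity_pt, smooth_is_derive, Hf.
        + apply continuity_2d_pt_id1.
      - apply (continuity_1d_2d_pt_comp G (fun _ s => s)).
        + eapply is_derive_continuity_pt, smooth_is_derive, Hg.
        + apply continuity_2d_pt_id2. }
    destruct (HC (mkposreal eps Heps)) as [d Hd].
    exists d. split; [apply cond_pos | intros t' s' h1 h2; now apply Hd].
  - intros t s. rewrite !pder_prod by assumption.
    split; apply is_derive_Reals; simpl length.
    + apply is_derive_mult_const_r. now apply smooth_is_derive.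
    + apply (is_derive_scal (nDer _ g)). now apply smooth_is_derive.
Qed.

(** * Second variation along the test functions *)

Lemma is_RInt_sin_sqr (l : R) : 0 < l ->
  is_RInt (fun t => sin (PI / l * t) ^ 2) 0 l (l / 2).
Proof.
  intros Hl. assert (HP := PI_RGT_0).
  replace (l / 2) with (minus (l / 2 - sin (2 * (PI / l * l)) / (4 * (PI / l)))
                          (0 / 2 - sin (2 * (PI / l * 0)) / (4 * (PI / l)))).
  - apply (is_RInt_derive (fun t => t / 2 - sin (2 * (PI / l * t)) / (4 * (PI / l)))).
    + intros t _. auto_derive; [exact I |].
      rewrite cos_2a_sin. field. split; lra.
    + intros t _. apply (ex_derive_continuous (fun t => sin (PI / l * t) ^ 2)).
      auto_derive. exact I.
  - replace (PI / l * l) with PI by (field; lra).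
    rewrite sin_2PI, !Rmult_0_r, sin_0. unfold minus, plus, opp; simpl. lra.
Qed.

Lemma is_RInt_FTC (f df : R -> R) (a b : R) :
  (forall x, is_derive f x (df x)) -> (forall x, continuous df x) ->
  is_RInt df a b (f b - f a).
Proof.
  intros Hd Hc.
  exact (is_RInt_derive f df a b (fun x _ => Hd x) (fun x _ => Hc x)).
Qed.

Lemma is_RInt_periodic_derive (f df : R -> R) (L : R) :
  (forall s, is_derive f s (df s)) -> (forall s, continuous df s) ->
  f L = f 0 -> is_RInt df 0 L 0.
Proof.
  intros Hd Hc HL. evar_last; [now apply (is_RInt_FTC f) | lra].
Qed.

Lemma is_derive_periodic (f df : R -> R) (L : R) :
  (forall s, is_derive f s (df s)) -> (forall s, f (s + L) = f s) ->
  forall s, df (s + L) = df s.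
Proof.
  intros Hd Hp s.
  rewrite <- (is_derive_unique f s (df s)) by apply Hd.
  symmetry. apply is_derive_unique.
  apply (is_derive_ext (fun t => f (t + L))); [exact Hp |].
  evar_last.
  - apply (is_derive_comp f (fun t => t + L) s); [apply Hd |].
    auto_derive; [exact I | reflexivity].
  - unfold scal; simpl; unfold mult; simpl. ring.
Qed.

(** The zero-order coefficient [|sigma|^2 - 2 a (h - x3 N3)] on the column, where [N3 = 0] and
    [h = - w]. *)
Definition column_potential (a1 a2 : R -> R) (a s : R) : R :=
  kappa a1 a2 s ^ 2 + 2 * a * (a1 s * Der a2 s - a2 s * Der a1 s).

(** Separation of variables: the sine is an eigenfunction of the second [t]-derivative, and its
    square integrates to [l / 2]. The factor [- (2 / l)] leaves a quadratic form in [g] alone. *)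
Lemma Phi_prod (a1 a2 g : R -> R) (L l a : R) :
  0 < l -> smooth a1 -> smooth a2 -> smooth g ->
  is_RInt (fun s => g s * (nDer 2 g s + (column_potential a1 a2 a s - (PI / l) ^ 2) * g s))
    0 L (- (2 / l) * Phi a1 a2 L l a (fun t s => sin (PI / l * t) * g s)).
Proof.
  intros Hl H1 H2 Hg.
  set (Q := fun s => g s * (nDer 2 g s + (column_potential a1 a2 a s - (PI / l) ^ 2) * g s)).
  assert (HQ : exists v : R, is_RInt Q 0 L v).
  { apply (ex_RInt_continuous Q). intros s _. apply (ex_derive_continuous Q).
    unfold Q, column_potential, kappa.
    auto_derive. simpl.
    repeat match goal with |- _ /\ _ => split end; try exact I;
      first [ eexists; apply (smooth_is_derive _ 0); assumption
            | eexists; apply (smooth_is_derive _ 1); assumption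
            | eexists; apply (smooth_is_derive _ 2); assumption ]. }
  destruct HQ as [v Hv].
  cut (Phi a1 a2 L l a (fun t s => sin (PI / l * t) * g s) = - (l / 2 * v)).
  { intros ->. replace (- (2 / l) * - (l / 2 * v)) with v by (field; lra). exact Hv. }
  unfold Phi, IntM. f_equal.
  apply RInt_Defs_unique.
  apply (is_RInt_ext (fun s => l / 2 * Q s));
    [| exact (is_RInt_scal Q 0 L (l / 2) v Hv)].
  intros s _. symmetry. apply RInt_Defs_unique.
  rewrite (Rmult_comm (l / 2)).
  apply (is_RInt_ext (fun t => Q s * sin (PI / l * t) ^ 2));
    [| exact (is_RInt_scal _ 0 l (Q s) (l / 2) (is_RInt_sin_sqr l Hl))].
  intros t _.
  change (Lap (fun t s => sin (PI / l * t) * g s) t s)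
    with (pder (true :: true :: nil) (fun t s => sin (PI / l * t) * g s) t s
          + pder (false :: false :: nil) (fun t s => sin (PI / l * t) * g s) t s).
  rewrite !(pder_prod (fun t => sin (PI / l * t)) g) by (try apply smooth_sin; assumption).
  cbv [filter length negb]. rewrite !nDer_sin.
  replace (PI / l * t + INR 2 * (PI / 2)) with (PI / l * t + PI) by (simpl; lra).
  rewrite neg_sin. change (INR 0) with 0.
  replace (PI / l * t + 0 * (PI / 2)) with (PI / l * t) by ring.
  unfold Q, column_potential, sigma2, hM, x3, N3, NM, xM, alpha', cross, dot3, E3; simpl.
  ring.
Qed.

Lemma IntM_sin_prod (g : R -> R) (L l : R) :
  is_RInt g 0 L 0 -> IntM L l (fun t s => sin (PI / l * t) * g s) = 0.
Proof.
  intros Hg. unfold IntM. apply RInt_Defs_unique.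
  set (S := fun t => sin (PI / l * t)).
  assert (HS : exists c : R, is_RInt S 0 l c).
  { apply (ex_RInt_continuous S). intros t _. apply (ex_derive_continuous S).
    unfold S. auto_derive. exact I. }
  destruct HS as [c Hc].
  apply (is_RInt_ext (fun s => c * g s)).
  - intros s _. symmetry. apply RInt_Defs_unique.
    rewrite (Rmult_comm c). apply (is_RInt_ext (fun t => g s * S t));
      [intros t _; apply Rmult_comm | exact (is_RInt_scal S 0 l (g s) c Hc)].
  - replace 0 with (c * 0) at 2 by ring. exact (is_RInt_scal g 0 L c 0 Hg).
Qed.

(* The test functions [sin (pi t / l) <alpha', E_i>] have [<alpha', alpha'''> = - kappa^2],
   which cancels the term [|sigma|^2] of the Jacobi operator. *)
Lemma stable_height_bound (a1 a2 : R -> R) (L l a : R) :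
  0 < L -> 0 < l -> smooth a1 -> smooth a2 ->
  (forall s, a1 (s + L) = a1 s /\ a2 (s + L) = a2 s) ->
  (forall s, Der a1 s ^ 2 + Der a2 s ^ 2 = 1) ->
  stable a1 a2 L l a ->
  2 * a * RInt (fun s => a1 s * Der a2 s - a2 s * Der a1 s) 0 L <= (PI / l) ^ 2 * L.
Proof.
  intros HL Hl H1 H2 Hper Hunit Hst.
  assert (D1 := fun n s => smooth_is_derive a1 n s H1).
  assert (D2 := fun n s => smooth_is_derive a2 n s H2).
  assert (K : forall f, smooth f -> (forall s, f (s + L) = f s) ->
            Phi a1 a2 L l a (fun t s => sin (PI / l * t) * Der f s) >= 0).
  { intros f Hf Hp. apply Hst.
    - apply (smooth2_prod (fun t => sin (PI / l * t))); [apply smooth_sin |].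
      now apply smooth_Der.
    - intros t s. f_equal.
      apply (is_derive_periodic f (Der f)); [| exact Hp].
      intros x. now apply (smooth_is_derive f 0).
    - intros s. rewrite Rmult_0_r, sin_0.
      replace (PI / l * l) with PI by (field; lra). rewrite sin_PI. lra.
    - apply IntM_sin_prod. apply (is_RInt_periodic_derive f).
      + intros x. now apply (smooth_is_derive f 0).
      + intros x. apply (ex_derive_continuous (Der f)).
        eexists. now apply (smooth_is_derive f 1).
      + rewrite <- (Hp 0). f_equal. ring. }
  assert (P1 := K a1 H1 (fun s => proj1 (Hper s))).
  assert (P2 := K a2 H2 (fun s => proj2 (Hper s))). clear K.
  assert (I1 := Phi_prod a1 a2 (Der a1) L l a Hl H1 H2 (smooth_Der _ H1)).
  assert (I2 := Phi_prod a1 a2 (Der a2) L l a Hl H1 H2 (smooth_Der _ H2)).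
  set (F1 := Phi _ _ _ _ _ _) in *. set (F2 := Phi _ _ _ _ _ _) in I2, P2.
  assert (IW : ex_RInt (fun s => a1 s * Der a2 s - a2 s * Der a1 s) 0 L).
  { apply (ex_RInt_continuous (fun s => a1 s * Der a2 s - a2 s * Der a1 s)).
    intros s _. apply (ex_derive_continuous (fun s => a1 s * Der a2 s - a2 s * Der a1 s)).
    auto_derive.
    assert (X1 : ex_derive a1 s) by (eexists; apply (D1 0%nat)).
    assert (X2 : ex_derive a2 s) by (eexists; apply (D2 0%nat)).
    assert (Y1 : ex_derive (Der a1) s) by (eexists; apply (D1 1%nat)).
    assert (Y2 : ex_derive (Der a2) s) by (eexists; apply (D2 1%nat)).
    exact (conj X1 (conj Y2 (conj X2 (conj Y1 I)))). }
  apply (RInt_correct (V := R_CompleteNormedModule)) in IW. set (w := RInt _ _ _) in *.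
  assert (IS : is_RInt (fun s => 2 * a * (a1 s * Der a2 s - a2 s * Der a1 s) - (PI / l) ^ 2)
                 0 L (2 * a * w - (PI / l) ^ 2 * L)).
  { replace ((PI / l) ^ 2 * L) with (scal (L - 0) ((PI / l) ^ 2))
      by (unfold scal; simpl; unfold mult; simpl; ring).
    apply (is_RInt_minus (fun s => 2 * a * (a1 s * Der a2 s - a2 s * Der a1 s))
             (fun _ => (PI / l) ^ 2)); [| apply (is_RInt_const 0 L ((PI / l) ^ 2))].
    apply (is_RInt_scal _ 0 L (2 * a) w IW). }
  assert (I12 := is_RInt_plus _ _ 0 L _ _ I1 I2).
  assert (E : 2 * a * w - (PI / l) ^ 2 * L = - (2 / l) * (F1 + F2)).
  { rewrite <- (is_RInt_unique _ _ _ _ IS).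
    apply is_RInt_unique.
    replace (- (2 / l) * (F1 + F2)) with (plus (- (2 / l) * F1) (- (2 / l) * F2))
      by (unfold plus; simpl; ring).
    eapply is_RInt_ext; [| exact I12].
    intros s _.
    cut (Der a1 s * (nDer 2 (Der a1) s + (column_potential a1 a2 a s - (PI / l) ^ 2) * Der a1 s)
         + Der a2 s * (nDer 2 (Der a2) s + (column_potential a1 a2 a s - (PI / l) ^ 2) * Der a2 s)
         = 2 * a * (a1 s * Der a2 s - a2 s * Der a1 s) - (PI / l) ^ 2); [exact (fun e => e) |].
    rewrite !nDer_Der.
    (* [U0] and [U1] come from differentiating [|alpha'|^2 = 1] once and twice. *)
    assert (U0 : forall s, Der a1 s * nDer 2 a1 s + Der a2 s * nDer 2 a2 s = 0).
    { intros x. assert (is_derive (fun s => Der a1 s ^ 2 + Der a2 s ^ 2) x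
        (2 * (Der a1 x * nDer 2 a1 x + Der a2 x * nDer 2 a2 x))).
      { apply (is_derive_ext (fun s => Der a1 s ^ 2 + Der a2 s ^ 2)); [reflexivity |].
        evar_last; [ apply (is_derive_plus (fun s => Der a1 s ^ 2) (fun s => Der a2 s ^ 2));
                     apply is_derive_pow; [apply (D1 1%nat) | apply (D2 1%nat)] |].
        unfold plus; simpl. ring. }
      assert (is_derive (fun s => Der a1 s ^ 2 + Der a2 s ^ 2) x 0).
      { apply (is_derive_ext (fun _ => 1)); [intros; now rewrite Hunit |].
        apply (is_derive_const (1:R)). }
      assert (E := is_derive_unique _ _ _ H). rewrite (is_derive_unique _ _ _ H0) in E. lra. }
    assert (U1 : Der a1 s * nDer 3 a1 s + Der a2 s * nDer 3 a2 s
                 + nDer 2 a1 s ^ 2 + nDer 2 a2 s ^ 2 = 0).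
    { assert (is_derive (fun s => Der a1 s * nDer 2 a1 s + Der a2 s * nDer 2 a2 s) s
        (Der a1 s * nDer 3 a1 s + Der a2 s * nDer 3 a2 s
                 + nDer 2 a1 s ^ 2 + nDer 2 a2 s ^ 2)).
      { evar_last; [ apply (is_derive_plus (fun s => Der a1 s * nDer 2 a1 s)
                              (fun s => Der a2 s * nDer 2 a2 s));
                     [ exact (is_derive_mult _ _ _ _ _ (D1 1%nat s) (D1 2%nat s) Rmult_comm)
                     | exact (is_derive_mult _ _ _ _ _ (D2 1%nat s) (D2 2%nat s) Rmult_comm) ] |].
        unfold plus, mult; simpl. unfold mult; simpl. ring. }
      assert (is_derive (fun s => Der a1 s * nDer 2 a1 s + Der a2 s * nDer 2 a2 s) s 0).
      { apply (is_derive_ext (fun _ => 0)); [intros; now rewrite U0 |].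
        apply (is_derive_const (0:R)). }
      assert (E := is_derive_unique _ _ _ H). rewrite (is_derive_unique _ _ _ H0) in E. lra. }
    specialize (U0 s). specialize (Hunit s).
    (* Lagrange's identity for [alpha'] and [alpha''], which are orthogonal with [|alpha'| = 1]. *)
    assert (UK : kappa a1 a2 s ^ 2 = nDer 2 a1 s ^ 2 + nDer 2 a2 s ^ 2).
    { transitivity (kappa a1 a2 s ^ 2
        + (Der a1 s * nDer 2 a1 s + Der a2 s * nDer 2 a2 s) ^ 2).
      - rewrite U0. ring.
      - unfold kappa.
        transitivity ((nDer 2 a1 s ^ 2 + nDer 2 a2 s ^ 2) * (Der a1 s ^ 2 + Der a2 s ^ 2));
          [| rewrite Hunit]; ring. }
    unfold column_potential. rewrite UK.
    set (ww := a1 s * Der a2 s - a2 s * Der a1 s).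
    transitivity ((Der a1 s * nDer 3 a1 s + Der a2 s * nDer 3 a2 s)
      + (nDer 2 a1 s ^ 2 + nDer 2 a2 s ^ 2 + 2 * a * ww - (PI / l) ^ 2)
        * (Der a1 s ^ 2 + Der a2 s ^ 2)); [ring |].
    rewrite Hunit. lra. }
  assert (0 < 2 / l) by (apply Rdiv_lt_0_compat; lra).
  nra.
Qed.

(** * Bump functions *)

Definition clamp (x : R) : R := Rmax (-1) (Rmin 1 x).

(** Only the two ends need care. There [clamp] moves by at most the increment of its argument, so
    the difference quotient is dominated by one of [P], which tends to 0. *)
Lemma is_derive_comp_clamp (P dP : R -> R) :
  (forall x, is_derive P x (dP x)) -> dP 1 = 0 -> dP (-1) = 0 ->
  forall x, is_derive (fun y => P (clamp y)) x (dP (clamp x)).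
Proof.
  intros HP H1 Hm1 x.
  assert (Hend : forall e, (forall h, Rabs (clamp (e + h) - e) <= Rabs h) ->
                 dP e = 0 -> is_derive (fun y => P (clamp y)) e 0).
  { intros e Hlip He.
    assert (Hce : clamp e = e).
    { assert (Z := Hlip 0). rewrite Rplus_0_r, Rabs_R0 in Z.
      assert (Z' := Rabs_pos (clamp e - e)).
      assert (Rabs (clamp e - e) = 0) by lra.
      destruct (Req_dec (clamp e - e) 0) as [| n]; [lra |].
      now apply Rabs_no_R0 in n. }
    apply is_derive_Reals. intros eps Heps.
    assert (D := HP e). rewrite He in D. apply is_derive_Reals in D.
    destruct (D eps Heps) as [d Hd]. exists d. intros h Hh Hhd.
    rewrite Hce. specialize (Hlip h).
    set (k := clamp (e + h) - e) in *.
    replace (clamp (e + h)) with (e + k) by (unfold k; ring).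
    assert (Hh' := Rabs_pos_lt h Hh).
    destruct (Req_dec k 0) as [-> | Hk].
    - rewrite Rplus_0_r. unfold Rdiv. rewrite Rminus_diag, Rmult_0_l, Rminus_0_r, Rabs_R0.
      exact Heps.
    - specialize (Hd k Hk ltac:(lra)).
      rewrite Rminus_0_r in *.
      assert (Hk' := Rabs_pos_lt k Hk).
      rewrite Rabs_div in * by assumption.
      apply Rlt_div_l; [lra |]. apply Rlt_div_l in Hd; [| lra]. nra. }
  assert (Hcl : forall y, clamp y = if Rle_dec y (-1) then -1 else if Rle_dec 1 y then 1 else y).
  { intros y. unfold clamp.
    destruct (Rle_dec y (-1)) as [h | h].
    - rewrite (Rmin_right 1 y) by lra. apply Rmax_left; lra.
    - destruct (Rle_dec 1 y) as [h' | h'].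
      + rewrite Rmin_left by lra. apply Rmax_right; lra.
      + rewrite (Rmin_right 1 y) by lra. apply Rmax_right; lra. }
  destruct (Rtotal_order x (-1)) as [h | [-> | h]].
  - replace (dP (clamp x)) with 0
      by (rewrite Hcl; destruct (Rle_dec x (-1)); [now rewrite Hm1 | lra]).
    apply (is_derive_ext_loc (fun _ => P (-1))); [| apply (is_derive_const (P (-1)))].
    apply (locally_interval _ x m_infty (-1)); [exact I | exact h |].
    intros y _ Hy. rewrite Hcl. destruct (Rle_dec y (-1)); [reflexivity |]. simpl in Hy; lra.
  - replace (dP (clamp (-1))) with 0
      by (rewrite Hcl; destruct (Rle_dec (-1) (-1)); [now rewrite Hm1 | lra]).
    apply Hend; [| exact Hm1].
    intros k. rewrite Hcl.
    destruct (Rle_dec (-1 + k) (-1)); [rewrite Rminus_diag, Rabs_R0; apply Rabs_pos |].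
    destruct (Rle_dec 1 (-1 + k)); rewrite !Rabs_pos_eq by lra; lra.
  - destruct (Rtotal_order x 1) as [h' | [-> | h']].
    + replace (dP (clamp x)) with (dP x)
        by (rewrite Hcl; destruct (Rle_dec x (-1)); [lra |]; destruct (Rle_dec 1 x); lra || reflexivity).
      apply (is_derive_ext_loc P); [| apply HP].
      apply (locally_interval _ x (-1) 1); [exact h | exact h' |].
      intros y Hy Hy'. rewrite Hcl. simpl in Hy, Hy'.
      destruct (Rle_dec y (-1)); [lra |]; destruct (Rle_dec 1 y); lra || reflexivity.
    + replace (dP (clamp 1)) with 0
        by (rewrite Hcl; destruct (Rle_dec 1 (-1)); [lra |]; destruct (Rle_dec 1 1); [now rewrite H1 | lra]).
      apply Hend; [| exact H1].
      intros k. rewrite Hcl.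
      destruct (Rle_dec (1 + k) (-1)); [rewrite !Rabs_left by lra; lra |].
      destruct (Rle_dec 1 (1 + k)); [rewrite Rminus_diag, Rabs_R0; apply Rabs_pos |].
      rewrite !Rabs_left by lra; lra.
    + replace (dP (clamp x)) with 0
        by (rewrite Hcl; destruct (Rle_dec x (-1)); [lra |]; destruct (Rle_dec 1 x); [now rewrite H1 | lra]).
      apply (is_derive_ext_loc (fun _ => P 1)); [| apply (is_derive_const (P 1))].
      apply (locally_interval _ x 1 p_infty); [exact h' | exact I |].
      intros y Hy _. rewrite Hcl. simpl in Hy.
      destruct (Rle_dec y (-1)); [lra |]; destruct (Rle_dec 1 y); lra || reflexivity.
Qed.

(** At scale [d], [psi] approximates the Dirac mass, [Psi] the Heaviside step, and [Psi2] the
    positive part up to a constant on the right. [Psi2] serves to integrate [Psi] explicitly; the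
    constant [c] stays unspecified because it cancels along a closed curve. *)
Record bump (d : R) (Psi2 Psi psi dpsi : R -> R) : Prop := {
  bump_Psi2 : forall x, is_derive Psi2 x (Psi x);
  bump_Psi : forall x, is_derive Psi x (psi x);
  bump_psi : forall x, is_derive psi x (dpsi x);
  bump_dpsi : forall x, continuous dpsi x;
  bump_ge0 : forall x, 0 <= psi x;
  bump_supp : forall x, d <= Rabs x -> psi x = 0;
  bump_left : forall x, x <= - d -> Psi x = 0;
  bump_right : forall x, d <= x -> Psi x = 1;
  bump_left2 : forall x, x <= - d -> Psi2 x = 0;
  bump_right2 : exists c, forall x, d <= x -> Psi2 x = x + c }.

Lemma clamp_left (x : R) : x <= -1 -> clamp x = -1.
Proof. intros h. unfold clamp. rewrite (Rmin_right 1 x) by lra. apply Rmax_left; lra. Qed.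

Lemma clamp_right (x : R) : 1 <= x -> clamp x = 1.
Proof. intros h. unfold clamp. rewrite Rmin_left by lra. apply Rmax_right; lra. Qed.

Lemma continuous_clamp (x : R) : continuous clamp x.
Proof.
  apply continuity_pt_filterlim. intros eps Heps. exists eps. split; [exact Heps |].
  intros y [_ Hy]. unfold dist in *; simpl in *; unfold Rdist in *.
  apply Rle_lt_trans with (2 := Hy). unfold clamp, Rmax, Rmin.
  destruct (Rle_dec 1 y), (Rle_dec 1 x); repeat destruct (Rle_dec _ _);
    unfold Rabs; repeat destruct (Rcase_abs _); lra.
Qed.

Lemma bump_unit : exists Psi2 Psi psi dpsi, bump 1 Psi2 Psi psi dpsi.
Proof.
  (* [Q] vanishes to second order at both ends, so its derivative vanishes there too. The factor
     [15 / 16] makes its integral over [[-1, 1]] equal to 1, and [1 / 2] gives [P (-1) = 0] and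
     [P 1 = 1]. *)
  set (P := fun x : R => 1 / 2 + 15 / 16 * (x - 2 / 3 * x ^ 3 + 1 / 5 * x ^ 5)).
  set (Q := fun x : R => 15 / 16 * (1 - x ^ 2) ^ 2).
  set (Q' := fun x : R => 15 / 16 * (2 * (1 - x ^ 2) * (- 2 * x))).
  assert (DP : forall x, is_derive P x (Q x))
    by (intros x; unfold P, Q; auto_derive; [exact I | field]).
  assert (DQ : forall x, is_derive Q x (Q' x))
    by (intros x; unfold Q, Q'; auto_derive; [exact I | field]).
  set (Psi := fun x => P (clamp x)).
  assert (DPsi : forall x, is_derive Psi x (Q (clamp x)))
    by (apply is_derive_comp_clamp; [exact DP | unfold Q; field | unfold Q; field]).
  assert (CPsi : forall x, continuous Psi x)
    by (intros x; apply (ex_derive_continuous Psi); eexists; apply DPsi).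
  assert (IPsi : forall u v, ex_RInt Psi u v)
    by (intros u v; apply (ex_RInt_continuous Psi); intros; apply CPsi).
  assert (L0 : forall x, x <= -1 -> Psi x = 0)
    by (intros x h; unfold Psi; rewrite clamp_left by exact h; unfold P; field).
  assert (R1 : forall x, 1 <= x -> Psi x = 1)
    by (intros x h; unfold Psi; rewrite clamp_right by exact h; unfold P; field).
  exists (fun x => RInt Psi (-1) x), Psi, (fun x => Q (clamp x)), (fun x => Q' (clamp x)).
  split.
  - intros x. apply (is_derive_RInt Psi (fun x => RInt Psi (-1) x) (-1)); [| apply CPsi].
    apply filter_forall. intros y. apply (RInt_correct Psi), IPsi.
  - exact DPsi.
  - apply is_derive_comp_clamp; [exact DQ | unfold Q'; field | unfold Q'; field].
  - intros x. apply (continuous_comp clamp Q'); [apply continuous_clamp |].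
    apply (ex_derive_continuous Q'). unfold Q'. auto_derive. exact I.
  - intros x. unfold Q. assert (H := pow2_ge_0 (1 - clamp x ^ 2)). lra.
  - intros x h. unfold Q.
    destruct (Rcase_abs x) as [n | p].
    + rewrite Rabs_left in h by exact n. rewrite clamp_left by lra. field.
    + rewrite Rabs_right in h by exact p. rewrite clamp_right by lra. field.
  - exact L0.
  - exact R1.
  - intros x h. apply is_RInt_unique.
    apply (is_RInt_ext (fun _ => 0)).
    + intros y. rewrite Rmax_left by lra. intros [_ hy]. rewrite L0 by lra. reflexivity.
    + evar_last; [apply is_RInt_const |]. unfold scal; simpl; unfold mult; simpl; ring.
  - exists (RInt Psi (-1) 1 - 1). intros x h.
    rewrite <- (RInt_Chasles Psi (-1) 1 x) by apply IPsi.
    rewrite (is_RInt_unique Psi 1 x (x - 1)).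
    + unfold plus; simpl. ring.
    + apply (is_RInt_ext (fun _ => 1)).
      * intros y. rewrite Rmin_left by lra. intros [hy _]. rewrite R1 by lra. reflexivity.
      * evar_last; [apply is_RInt_const |]. unfold scal; simpl; unfold mult; simpl; ring.
Qed.

Lemma is_derive_comp_scaled (f df : R -> R) (k d x : R) :
  (forall y, is_derive f y (df y)) ->
  is_derive (fun y => k * f (y / d)) x (k / d * df (x / d)).
Proof.
  intros Hf. replace (k / d * df (x / d)) with (k * (/ d * df (x / d)))
    by (unfold Rdiv; ring).
  apply (is_derive_scal (fun y => f (y / d))).
  apply (is_derive_comp f (fun y => y / d)); [apply Hf |].
  auto_derive; [exact I | unfold Rdiv; ring].
Qed.

Lemma bump_exists (d : R) : 0 < d -> exists Psi2 Psi psi dpsi, bump d Psi2 Psi psi dpsi.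
Proof.
  intros Hd. destruct bump_unit as (F & G & g & g' & [B1 B2 B3 B4 B5 B6 B7 B8 B9 [c B10]]).
  exists (fun x => d * F (x / d)), (fun x => 1 * G (x / d)),
    (fun x => 1 / d * g (x / d)), (fun x => 1 / d / d * g' (x / d)).
  assert (Hl : forall x, x <= - d -> x / d <= - 1)
    by (intros x h; apply Rle_div_l; lra).
  assert (Hr : forall x, d <= x -> 1 <= x / d)
    by (intros x h; apply Rle_div_r; lra).
  assert (Hid : 0 < 1 / d) by (apply Rdiv_lt_0_compat; lra).
  split; intros.
  - replace 1 with (d / d) by (field; lra). now apply is_derive_comp_scaled.
  - now apply is_derive_comp_scaled.
  - now apply is_derive_comp_scaled.
  - apply (continuous_scal_r (1 / d / d) (fun x => g' (x / d))).
    apply (continuous_comp (fun x => x / d) g'); [| apply B4].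
    apply (ex_derive_continuous (fun x => x / d)). auto_derive. exact I.
  - apply Rmult_le_pos; [lra | apply B5].
  - rewrite B6; [ring |]. rewrite Rabs_div by lra. rewrite (Rabs_pos_eq d) by lra.
    now apply Hr.
  - rewrite B7 by now apply Hl. ring.
  - rewrite B8 by now apply Hr. ring.
  - rewrite B9 by now apply Hl. ring.
  - exists (d * c). intros x h. rewrite B10 by now apply Hr. field. lra.
Qed.

(** * Unit speed closed curves *)

(** The area inequality is a statement about [C^2] curves: [b] is the velocity, [c] the
    acceleration, and the left normal is [(- b2, b1)]. *)
Record unit_speed_curve (L : R) (a1 a2 b1 b2 c1 c2 : R -> R) : Prop := {
  usc_L : 0 < L;
  usc_a1L : forall s, a1 (s + L) = a1 s;
  usc_a2L : forall s, a2 (s + L) = a2 s;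
  usc_a1 : forall s, is_derive a1 s (b1 s);
  usc_a2 : forall s, is_derive a2 s (b2 s);
  usc_b1 : forall s, is_derive b1 s (c1 s);
  usc_b2 : forall s, is_derive b2 s (c2 s);
  usc_c1 : forall s, continuous c1 s;
  usc_c2 : forall s, continuous c2 s;
  usc_unit : forall s, b1 s ^ 2 + b2 s ^ 2 = 1;
  usc_inj : forall s s', 0 <= s < L -> 0 <= s' < L ->
    a1 s = a1 s' -> a2 s = a2 s' -> s = s' }.

Lemma periodic_Z (f : R -> R) (L : R) : (forall s, f (s + L) = f s) ->
  forall (k : Z) s, f (s + IZR k * L) = f s.
Proof.
  intros H.
  assert (N : forall n s, f (s + INR n * L) = f s).
  { induction n as [| n IH]; intros s.
    - f_equal. simpl. ring.
    - rewrite <- (IH s), <- (H (s + INR n * L)). f_equal. rewrite S_INR. ring. }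
  intros k s. destruct (Z.le_gt_cases 0 k) as [h | h].
  - rewrite <- (Z2Nat.id k h), <- INR_IZR_INZ. apply N.
  - rewrite <- (N (Z.to_nat (- k)) (s + IZR k * L)). f_equal.
    rewrite INR_IZR_INZ, Z2Nat.id by lia. rewrite opp_IZR. ring.
Qed.

Lemma period_reduce (L s : R) : 0 < L -> exists k : Z, 0 <= s + IZR k * L < L.
Proof.
  intros HL. exists (- Int_part (s / L))%Z.
  destruct (base_Int_part (s / L)) as [h1 h2].
  rewrite opp_IZR. set (q := IZR (Int_part (s / L))) in *.
  assert (E : s = s / L * L) by (field; lra).
  set (t := s / L) in *. clearbody t q. rewrite E. split; nra.
Qed.

Lemma periodic_min (f : R -> R) (L : R) : 0 < L ->
  (forall s, f (s + L) = f s) -> (forall s, continuity_pt f s) ->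
  exists s0, forall s, f s0 <= f s.
Proof.
  intros HL HfL Hc.
  destruct (continuity_ab_min f 0 L) as [s0 [Hs0 _]]; [lra | intros; apply Hc |].
  exists s0. intros s. destruct (period_reduce L s HL) as [k Hk].
  rewrite <- (periodic_Z f L HfL k s). apply Hs0. lra.
Qed.

Lemma is_derive_min (f : R -> R) (x y : R) :
  is_derive f x y -> (forall z, f x <= f z) -> y = 0.
Proof.
  intros Hd Hm.
  assert (pr : derivable_pt f x) by (exists y; now apply is_derive_Reals).
  rewrite <- (deriv_minimum f (x - 1) (x + 1) x pr) by (lra || intros; apply Hm).
  symmetry. apply derive_pt_eq_0. now apply is_derive_Reals.
Qed.

Lemma mean_value (f df : R -> R) (x y : R) : (forall z, is_derive f z (df z)) ->
  exists z, Rabs (z - x) <= Rabs (y - x) /\ f y - f x = df z * (y - x).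
Proof.
  intros Hd.
  destruct (MVT_gen f x y df) as [z [Hz E]].
  - intros; apply Hd.
  - intros; eapply is_derive_continuity_pt, Hd.
  - exists z. split; [| exact E]. revert Hz. unfold Rmin, Rmax.
    destruct (Rle_dec x y); intros; unfold Rabs; repeat destruct (Rcase_abs _); lra.
Qed.

Lemma continuity_2d_pt_comp1 (f : R -> R) (x y : R) :
  continuity_pt f x -> continuity_2d_pt (fun u _ => f u) x y.
Proof.
  intros H. apply (continuity_1d_2d_pt_comp f (fun u _ => u)); [exact H |].
  apply continuity_2d_pt_id1.
Qed.

Lemma continuity_2d_pt_comp2 (f : R -> R) (x y : R) :
  continuity_pt f y -> continuity_2d_pt (fun _ v => f v) x y.
Proof.
  intros H. apply (continuity_1d_2d_pt_comp f (fun _ v => v)); [exact H |].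
  apply continuity_2d_pt_id2.
Qed.

Lemma rectangle_positive_bound (F : R -> R -> R) (a b a' b' : R) :
  (forall x y, continuity_2d_pt F x y) ->
  (forall x y, a <= x <= b -> a' <= y <= b' -> 0 < F x y) ->
  exists m, 0 < m /\ forall x y, a <= x <= b -> a' <= y <= b' -> m <= F x y.
Proof.
  intros Hc Hp.
  (* One number serves both as radius of a neighbourhood and as lower bound of [F] on it, so the
     uniform [d] from compactness is itself the bound sought. *)
  assert (Hloc : forall u v, exists d : posreal, a <= u <= b -> a' <= v <= b' ->
      forall x y, Rabs (x - u) < d -> Rabs (y - v) < d -> d <= F x y).
  { intros u v.
    destruct (excluded_middle_informative ((a <= u <= b) /\ (a' <= v <= b'))) as [[hu hv] | n].
    - assert (P := Hp u v hu hv).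
      assert (P2 : 0 < F u v / 2) by lra.
      destruct (Hc u v (mkposreal _ P2)) as [d Hd].
      assert (P3 : 0 < Rmin d (F u v / 2)) by (apply Rmin_pos; [apply cond_pos | lra]).
      exists (mkposreal _ P3). simpl. intros _ _ x y hx hy.
      assert (M1 := Rmin_l d (F u v / 2)). assert (M2 := Rmin_r d (F u v / 2)).
      assert (D := Hd x y ltac:(lra) ltac:(lra)). simpl in D.
      apply Rabs_def2 in D. lra.
    - exists (mkposreal 1 Rlt_0_1). intros hu hv. exfalso. now apply n. }
  set (delta := fun u v => proj1_sig (constructive_indefinite_description _ (Hloc u v))).
  assert (Hdelta : forall u v, a <= u <= b -> a' <= v <= b' ->
     forall x y, Rabs (x - u) < delta u v -> Rabs (y - v) < delta u v -> delta u v <= F x y)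
    by (intros u v; unfold delta; apply (proj2_sig (constructive_indefinite_description _ (Hloc u v)))).
  destruct (compactness_value_2d a b a' b' delta) as [d Hd].
  exists d. split; [apply cond_pos |]. intros x y hx hy.
  destruct (Rle_lt_dec d (F x y)) as [h | h]; [exact h | exfalso].
  apply (Hd x y hx hy). intros (u & v & hu & hv & h1 & h2 & h3).
  assert (Z := Hdelta u v hu hv x y h1 h2). lra.
Qed.

(** * Uniform estimates for simple closed curves *)

Lemma usc_b1L L a1 a2 b1 b2 c1 c2 : unit_speed_curve L a1 a2 b1 b2 c1 c2 ->
  forall s, b1 (s + L) = b1 s.
Proof. intros C. apply (is_derive_periodic a1); apply C. Qed.

Lemma usc_b2L L a1 a2 b1 b2 c1 c2 : unit_speed_curve L a1 a2 b1 b2 c1 c2 ->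
  forall s, b2 (s + L) = b2 s.
Proof. intros C. apply (is_derive_periodic a2); apply C. Qed.

Lemma acceleration_bound L a1 a2 b1 b2 c1 c2 : unit_speed_curve L a1 a2 b1 b2 c1 c2 ->
  exists K, 0 < K /\ forall s, Rabs (c1 s) + Rabs (c2 s) <= K.
Proof.
  intros C.
  assert (P1 : forall s, c1 (s + L) = c1 s)
    by (apply (is_derive_periodic b1); [apply C | now apply (usc_b1L L a1 a2 b1 b2 c1 c2)]).
  assert (P2 : forall s, c2 (s + L) = c2 s)
    by (apply (is_derive_periodic b2); [apply C | now apply (usc_b2L L a1 a2 b1 b2 c1 c2)]).
  destruct (periodic_min (fun s => - (Rabs (c1 s) + Rabs (c2 s))) L) as [s0 Hs0].
  - apply C.
  - intros s. now rewrite P1, P2.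
  - intros s. apply continuity_pt_opp, continuity_pt_plus;
      (apply (continuity_pt_comp _ Rabs); [apply continuity_pt_filterlim; apply C | apply Rcontinuity_abs]).
  - exists (Rabs (c1 s0) + Rabs (c2 s0) + 1).
    assert (A1 := Rabs_pos (c1 s0)). assert (A2 := Rabs_pos (c2 s0)).
    split; [lra |]. intros s. specialize (Hs0 s). lra.
Qed.

Lemma unit_component_bound (x y : R) : x ^ 2 + y ^ 2 = 1 -> Rabs x <= 1 /\ Rabs y <= 1.
Proof. intros H. split; apply Rabs_le; nra. Qed.

Lemma linear_combination_bound (x y u v K : R) :
  Rabs u <= 1 -> Rabs v <= 1 -> Rabs x + Rabs y <= K -> Rabs (x * u + y * v) <= K.
Proof.
  intros hu hv h. eapply Rle_trans; [apply Rabs_triang |]. rewrite !Rabs_mult.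
  assert (A1 := Rabs_pos x). assert (A2 := Rabs_pos y). nra.
Qed.

(** The mean value theorem fails for vectors, so it is applied to the component along a fixed
    direction [(u, v)]; the intermediate point depends on that direction. *)
Lemma velocity_variation L a1 a2 b1 b2 c1 c2 K : unit_speed_curve L a1 a2 b1 b2 c1 c2 ->
  (forall s, Rabs (c1 s) + Rabs (c2 s) <= K) ->
  forall u v s s', Rabs u <= 1 -> Rabs v <= 1 ->
  Rabs ((b1 s' * u + b2 s' * v) - (b1 s * u + b2 s * v)) <= K * Rabs (s' - s).
Proof.
  intros C HK u v s s' hu hv.
  destruct (mean_value (fun x => b1 x * u + b2 x * v) (fun x => c1 x * u + c2 x * v) s s')
    as [z [_ E]].
  - intros z. apply (is_derive_plus (fun x => b1 x * u) (fun x => b2 x * v));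
      apply is_derive_mult_const_r; apply C.
  - rewrite E, Rabs_mult. apply Rmult_le_compat_r; [apply Rabs_pos |].
    now apply linear_combination_bound.
Qed.

Lemma displacement_mean_value L a1 a2 b1 b2 c1 c2 : unit_speed_curve L a1 a2 b1 b2 c1 c2 ->
  forall u v s s', exists z, Rabs (z - s) <= Rabs (s' - s) /\
    (a1 s' - a1 s) * u + (a2 s' - a2 s) * v = (b1 z * u + b2 z * v) * (s' - s).
Proof.
  intros C u v s s'.
  destruct (mean_value (fun x => a1 x * u + a2 x * v) (fun x => b1 x * u + b2 x * v) s s')
    as [z [Hz E]].
  - intros z. apply (is_derive_plus (fun x => a1 x * u) (fun x => a2 x * v));
      apply is_derive_mult_const_r; apply C.
  - exists z. split; [exact Hz |]. rewrite <- E. ring.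
Qed.

Lemma sum_sqr_le0 (x y : R) : x ^ 2 + y ^ 2 <= 0 -> x = 0 /\ y = 0.
Proof.
  intros H. assert (Hx := pow2_ge_0 x). assert (Hy := pow2_ge_0 y).
  split; [destruct (Req_dec x 0) as [| n] | destruct (Req_dec y 0) as [| n]]; trivial;
    apply pow2_gt_0 in n; lra.
Qed.

(** The chord length is continuous and, by simplicity of the curve, positive on a compact rectangle
    of pairs [(s, h)]; periodicity brings every [s] into it. *)
Lemma chord_bound L a1 a2 b1 b2 c1 c2 (eta : R) : unit_speed_curve L a1 a2 b1 b2 c1 c2 ->
  0 < eta -> exists m, 0 < m /\ forall s h, eta <= h <= L - eta ->
    m <= (a1 (s + h) - a1 s) ^ 2 + (a2 (s + h) - a2 s) ^ 2.
Proof.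
  intros C Heta. assert (HL := usc_L _ _ _ _ _ _ _ C).
  set (F := fun s h => (a1 (s + h) - a1 s) ^ 2 + (a2 (s + h) - a2 s) ^ 2).
  assert (FL : forall k s h, F (s + IZR k * L) h = F s h).
  { intros k s h. unfold F.
    replace (s + IZR k * L + h) with (s + h + IZR k * L) by ring.
    rewrite !(periodic_Z a1 L), !(periodic_Z a2 L) by apply C. reflexivity. }
  destruct (rectangle_positive_bound F 0 L eta (L - eta)) as [m [Hm Hb]].
  - intros x y. unfold F.
    assert (Q : forall f df, (forall s, is_derive f s (df s)) ->
              continuity_2d_pt (fun s h => (f (s + h) - f s) ^ 2) x y).
    { intros f df Hf.
      assert (G : continuity_2d_pt (fun s h => f (s + h) - f s) x y).
      { apply continuity_2d_pt_minus.
        - apply (continuity_1d_2d_pt_comp f (fun s h => s + h));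
            [eapply is_derive_continuity_pt, Hf |].
          apply continuity_2d_pt_plus; [apply continuity_2d_pt_id1 | apply continuity_2d_pt_id2].
        - apply continuity_2d_pt_comp1. eapply is_derive_continuity_pt, Hf. }
      apply (continuity_2d_pt_ext (fun s h => (f (s + h) - f s) * (f (s + h) - f s)));
        [intros; ring | now apply continuity_2d_pt_mult]. }
    apply continuity_2d_pt_plus; [apply (Q a1 b1) | apply (Q a2 b2)]; apply C.
  - intros s h _ Hh.
    destruct (period_reduce L s HL) as [k Hk].
    rewrite <- (FL k s h). set (s0 := s + IZR k * L) in *. unfold F.
    destruct (Rle_lt_dec ((a1 (s0 + h) - a1 s0) ^ 2 + (a2 (s0 + h) - a2 s0) ^ 2) 0)
      as [n | p]; [exfalso | exact p].
    destruct (sum_sqr_le0 _ _ n) as [E1%Rminus_diag_uniq E2%Rminus_diag_uniq].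
    (* Injectivity is only given on one period, so a second parameter past [L] is moved back by
       [L]. *)
    destruct (Rlt_le_dec (s0 + h) L) as [h1 | h1].
    + assert (s0 + h = s0) by (apply (usc_inj _ _ _ _ _ _ _ C); lra). lra.
    + assert (s0 + h - L = s0); [| lra].
      apply (usc_inj _ _ _ _ _ _ _ C); try lra.
      * rewrite <- E1, <- (usc_a1L _ _ _ _ _ _ _ C (s0 + h - L)). f_equal. ring.
      * rewrite <- E2, <- (usc_a2L _ _ _ _ _ _ _ C (s0 + h - L)). f_equal. ring.
  - exists m. split; [exact Hm |]. intros s h Hh.
    destruct (period_reduce L s HL) as [k Hk].
    fold (F s h). rewrite <- (FL k s h). apply Hb; lra.
Qed.

(** A dichotomy for the distance on the circle [R / L Z]: [s''] is a translate of [s'] by periods,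
    hence carries the same point and the same tangent. *)
Lemma near_or_far L a1 a2 b1 b2 c1 c2 (eta : R) : unit_speed_curve L a1 a2 b1 b2 c1 c2 ->
  0 < eta -> exists m, 0 < m /\ forall s s',
    (exists s'', Rabs (s'' - s) <= eta /\ a1 s'' = a1 s' /\ a2 s'' = a2 s' /\
                 b1 s'' = b1 s' /\ b2 s'' = b2 s') \/
    m <= (a1 s' - a1 s) ^ 2 + (a2 s' - a2 s) ^ 2.
Proof.
  intros C Heta. destruct (chord_bound _ _ _ _ _ _ _ eta C Heta) as [m [Hm Hb]].
  exists m. split; [exact Hm |]. intros s s'.
  destruct (period_reduce L (s' - s) (usc_L _ _ _ _ _ _ _ C)) as [k Hk].
  assert (P : forall j, a1 (s' + IZR j * L) = a1 s' /\ a2 (s' + IZR j * L) = a2 s' /\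
     b1 (s' + IZR j * L) = b1 s' /\ b2 (s' + IZR j * L) = b2 s').
  { intros j. repeat split; apply periodic_Z; try apply C.
    - apply (usc_b1L _ _ _ _ _ _ _ C).
    - apply (usc_b2L _ _ _ _ _ _ _ C). }
  destruct (Rle_lt_dec (s' - s + IZR k * L) eta) as [h1 | h1];
    [| destruct (Rle_lt_dec (s' - s + IZR k * L) (L - eta)) as [h2 | h2]].
  - left. exists (s' + IZR k * L). split; [apply Rabs_le; lra | apply P].
  - right. specialize (Hb s (s' - s + IZR k * L) ltac:(lra)).
    replace (s + (s' - s + IZR k * L)) with (s' + IZR k * L) in Hb by ring.
    destruct (P k) as (E1 & E2 & _). rewrite E1, E2 in Hb. exact Hb.
  (* The reduced difference lies in the last [eta] of the period, so one period less puts the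
     translate just before [s]. *)
  - left. exists (s' + IZR (k - 1) * L). split; [| apply P].
    rewrite minus_IZR. apply Rabs_le. lra.
Qed.

Lemma near_tangent L a1 a2 b1 b2 c1 c2 : unit_speed_curve L a1 a2 b1 b2 c1 c2 ->
  exists eta, 0 < eta /\ forall s s', Rabs (s' - s) <= eta ->
    1 / 2 <= b1 s' * b1 s + b2 s' * b2 s.
Proof.
  intros C. destruct (acceleration_bound _ _ _ _ _ _ _ C) as [K [HK Hc]].
  exists (/ (2 * K)). split; [apply Rinv_0_lt_compat; lra |]. intros s s' h.
  assert (U := usc_unit _ _ _ _ _ _ _ C s).
  destruct (unit_component_bound _ _ U) as [u1 u2].
  assert (V := velocity_variation _ _ _ _ _ _ _ K C Hc (b1 s) (b2 s) s s' u1 u2).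
  replace (b1 s * b1 s + b2 s * b2 s) with 1 in V by lra.
  assert (K * Rabs (s' - s) <= 1 / 2).
  { replace (1 / 2) with (K * / (2 * K)) by (field; lra).
    apply Rmult_le_compat_l; lra. }
  apply Rabs_le_between in V. lra.
Qed.

Lemma close_points_tangent L a1 a2 b1 b2 c1 c2 : unit_speed_curve L a1 a2 b1 b2 c1 c2 ->
  exists m, 0 < m /\ forall s s',
    (a1 s' - a1 s) ^ 2 + (a2 s' - a2 s) ^ 2 < m -> 0 <= b1 s' * b1 s + b2 s' * b2 s.
Proof.
  intros C. destruct (near_tangent _ _ _ _ _ _ _ C) as [eta [Heta Ht]].
  destruct (near_or_far _ _ _ _ _ _ _ eta C Heta) as [m [Hm Hnf]].
  exists m. split; [exact Hm |]. intros s s' h.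
  destruct (Hnf s s') as [(s'' & h1 & _ & _ & <- & <-) | h1]; [| lra].
  specialize (Ht s s'' h1). lra.
Qed.

(* Equivalently, the circles of radius [r] tangent to the curve at [alpha s] have no point
   of the curve in their interior. *)
Lemma tangent_circle L a1 a2 b1 b2 c1 c2 : unit_speed_curve L a1 a2 b1 b2 c1 c2 ->
  exists rho, 0 < rho /\ forall s s' r, Rabs r <= rho ->
    2 * r * (- (a1 s' - a1 s) * b2 s + (a2 s' - a2 s) * b1 s)
    <= (a1 s' - a1 s) ^ 2 + (a2 s' - a2 s) ^ 2.
Proof.
  intros C. destruct (acceleration_bound _ _ _ _ _ _ _ C) as [K [HK Hc]].
  destruct (near_tangent _ _ _ _ _ _ _ C) as [eta [Heta Ht]].
  destruct (near_or_far _ _ _ _ _ _ _ eta C Heta) as [m [Hm Hnf]].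
  (* The first bound controls the curvature of the arc near [s], the second keeps the circle away
     from the other arcs. *)
  set (rho := Rmin (/ (8 * K)) (sqrt m / 2)).
  assert (Hsm := sqrt_lt_R0 m Hm).
  assert (R1 : rho <= / (8 * K)) by apply Rmin_l.
  assert (R2 : rho <= sqrt m / 2) by apply Rmin_r.
  assert (HiK : 0 < / (8 * K)) by (apply Rinv_0_lt_compat; lra).
  exists rho. split; [apply Rmin_pos; lra |].
  intros s s' r Hr.
  assert (U := usc_unit _ _ _ _ _ _ _ C s).
  destruct (unit_component_bound _ _ U) as [u1 u2].
  destruct (Hnf s s') as [(s'' & h1 & <- & <- & _ & _) | h1].
  - destruct (displacement_mean_value _ _ _ _ _ _ _ C (b1 s) (b2 s) s s'') as [z [Hz Ez]].
    destruct (displacement_mean_value _ _ _ _ _ _ _ C (- b2 s) (b1 s) s s'') as [y [Hy Ey]].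
    assert (Tz := Ht s z ltac:(lra)).
    assert (Vy := velocity_variation _ _ _ _ _ _ _ K C Hc (- b2 s) (b1 s) s y
                    ltac:(now rewrite Rabs_Ropp) u1).
    replace (b1 s * - b2 s + b2 s * b1 s) with 0 in Vy by ring. rewrite Rminus_0_r in Vy.
    set (X1 := a1 s'' - a1 s) in *. set (X2 := a2 s'' - a2 s) in *. set (h := s'' - s) in *.
    set (T := b1 z * b1 s + b2 z * b2 s) in *.
    set (N := b1 y * - b2 s + b2 y * b1 s) in *.
    replace (- X1 * b2 s + X2 * b1 s) with (N * h) by (rewrite <- Ey; ring).
    assert (EX : X1 ^ 2 + X2 ^ 2 = (T * h) ^ 2 + (N * h) ^ 2).
    { rewrite <- Ez, <- Ey.
      transitivity ((X1 ^ 2 + X2 ^ 2) * (b1 s ^ 2 + b2 s ^ 2)); [rewrite U |]; ring. }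
    rewrite EX.
    (* On the near arc the normal displacement is at most [K h^2] and [|r| K <= 1 / 8], while the
       tangential displacement is at least [|h| / 2]. *)
    assert (L1 : 2 * r * (N * h) <= h ^ 2 / 4).
    { apply Rle_trans with (Rabs (2 * r * (N * h))); [apply Rle_abs |].
      rewrite !Rabs_mult, (Rabs_pos_eq 2) by lra.
      rewrite <- (pow2_abs h). set (ah := Rabs h) in *.
      assert (0 <= ah) by apply Rabs_pos. assert (A0 := Rabs_pos r). assert (A1 := Rabs_pos N).
      assert (Rabs N <= K * ah) by nra.
      assert (Rabs r * K <= 1 / 8).
      { replace (1 / 8) with (/ (8 * K) * K) by (field; lra). apply Rmult_le_compat_r; lra. }
      apply Rle_trans with (2 * Rabs r * (K * ah * ah)).
      - apply Rmult_le_compat_l; [lra |]. apply Rmult_le_compat_r; lra.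
      - replace (2 * Rabs r * (K * ah * ah)) with (2 * (Rabs r * K) * (ah * ah)) by ring.
        nra. }
    assert (L2 : h ^ 2 / 4 <= (T * h) ^ 2).
    { replace ((T * h) ^ 2) with (T ^ 2 * h ^ 2) by ring.
      assert (0 <= h ^ 2) by apply pow2_ge_0. assert (1 / 4 <= T ^ 2) by nra. nra. }
    assert (0 <= (N * h) ^ 2) by apply pow2_ge_0. lra.
  (* On the far arcs the squared chord bounds both [N^2] and [4 r^2], hence also [2 r N] by the
     inequality of means. *)
  - set (X1 := a1 s' - a1 s) in *. set (X2 := a2 s' - a2 s) in *.
    set (N := - X1 * b2 s + X2 * b1 s).
    assert (EX : X1 ^ 2 + X2 ^ 2 = (X1 * b1 s + X2 * b2 s) ^ 2 + N ^ 2).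
    { unfold N. transitivity ((X1 ^ 2 + X2 ^ 2) * (b1 s ^ 2 + b2 s ^ 2)); [rewrite U |]; ring. }
    assert (N ^ 2 <= X1 ^ 2 + X2 ^ 2) by (assert (Z := pow2_ge_0 (X1 * b1 s + X2 * b2 s)); lra).
    assert (4 * r ^ 2 <= X1 ^ 2 + X2 ^ 2).
    { rewrite <- pow2_abs. assert (A0 := Rabs_pos r).
      rewrite <- (sqrt_sqrt m) in h1 by lra. nra. }
    assert (Z := pow2_ge_0 (N - 2 * r)). nra.
Qed.

(** Where the distance is minimal the connecting vector is normal to the curve. [d] is its signed
    normal coordinate, so its sign tells the side and [|d|] is the distance. *)
Lemma nearest_point L a1 a2 b1 b2 c1 c2 (p1 p2 : R) : unit_speed_curve L a1 a2 b1 b2 c1 c2 ->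
  exists s0 d, p1 = a1 s0 - d * b2 s0 /\ p2 = a2 s0 + d * b1 s0 /\
    forall s, d ^ 2 <= (a1 s - p1) ^ 2 + (a2 s - p2) ^ 2.
Proof.
  intros C. set (f := fun s => (a1 s - p1) ^ 2 + (a2 s - p2) ^ 2).
  assert (Hd : forall s, is_derive f s (2 * ((a1 s - p1) * b1 s + (a2 s - p2) * b2 s))).
  { intros s. unfold f.
    assert (Q : forall g dg p, is_derive g s dg -> is_derive (fun s => (g s - p) ^ 2) s (2 * ((g s - p) * dg))).
    { intros g dg p Hg. evar_last.
      - apply (is_derive_pow (fun s => g s - p) 2). apply (is_derive_minus g (fun _ => p)); [exact Hg |].
        apply (is_derive_const p).
      - unfold minus, plus, opp, zero; simpl. ring. }
    rewrite Rmult_plus_distr_l.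
    apply (is_derive_plus (fun s => (a1 s - p1) ^ 2) (fun s => (a2 s - p2) ^ 2)); apply Q; apply C. }
  destruct (periodic_min f L) as [s0 Hs0].
  - apply C.
  - intros s. unfold f. now rewrite (usc_a1L _ _ _ _ _ _ _ C), (usc_a2L _ _ _ _ _ _ _ C).
  - intros s. eapply is_derive_continuity_pt, Hd.
  - assert (E := is_derive_min f s0 _ (Hd s0) Hs0).
    assert (U := usc_unit _ _ _ _ _ _ _ C s0).
    set (X1 := a1 s0 - p1) in *. set (X2 := a2 s0 - p2) in *.
    assert (T : X1 * b1 s0 + X2 * b2 s0 = 0) by lra.
    exists s0, (X1 * b2 s0 - X2 * b1 s0).
    assert (E1 : X1 = (X1 * b2 s0 - X2 * b1 s0) * b2 s0).
    { transitivity (X1 * (b1 s0 ^ 2 + b2 s0 ^ 2) - (X1 * b1 s0 + X2 * b2 s0) * b1 s0); [rewrite U, T |]; ring. }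
    assert (E2 : X2 = - (X1 * b2 s0 - X2 * b1 s0) * b1 s0).
    { transitivity (X2 * (b1 s0 ^ 2 + b2 s0 ^ 2) - (X1 * b1 s0 + X2 * b2 s0) * b2 s0); [rewrite U, T |]; ring. }
    split; [| split].
    + rewrite <- E1. unfold X1. ring.
    + replace ((X1 * b2 s0 - X2 * b1 s0) * b1 s0) with (- X2) by (rewrite E2 at 1; ring). unfold X2. ring.
    + intros s. apply Rle_trans with (2 := Hs0 s). unfold f. fold X1 X2.
      replace (X1 ^ 2 + X2 ^ 2) with ((X1 * b2 s0 - X2 * b1 s0) ^ 2 + (X1 * b1 s0 + X2 * b2 s0) ^ 2).
      * rewrite T. lra.
      * transitivity ((X1 ^ 2 + X2 ^ 2) * (b1 s0 ^ 2 + b2 s0 ^ 2)); [| rewrite U]; ring.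
Qed.

(** * The mollified winding number *)

Lemma RInt_Ropp (f : R -> R) (a b : R) :
  ex_RInt f a b -> RInt (fun x => - f x) a b = - RInt f a b.
Proof. exact (RInt_opp f a b). Qed.

Lemma RInt_Rext (f g : R -> R) (a b : R) :
  (forall x, f x = g x) -> RInt f a b = RInt g a b.
Proof. intros H. apply RInt_ext. intros x _. apply H. Qed.

Lemma is_derive_RInt_param_all (f df : R -> R -> R) (a b x : R) :
  (forall u t, is_derive (fun u => f u t) u (df u t)) ->
  (forall t, continuity_2d_pt df x t) ->
  (forall u t, continuous (fun t => f u t) t) ->
  is_derive (fun u => RInt (fun t => f u t) a b) x (RInt (fun t => df x t) a b).
Proof.
  intros Hd Hc Hf.
  evar_last.
  - apply (is_derive_RInt_param f a b x).
    + apply filter_forall. intros u t _. exists (df u t). apply Hd.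
    + intros t _. apply (continuity_2d_pt_ext df); [| apply Hc].
      intros u v. symmetry. apply is_derive_unique, Hd.
    + apply filter_forall. intros u. apply (ex_RInt_continuous (fun t => f u t)).
      intros t _. apply Hf.
  - apply RInt_ext. intros t _. apply is_derive_unique, Hd.
Qed.

Lemma is_derive_RInt_shift (phi dphi a w : R -> R) (L p : R) :
  (forall x, is_derive phi x (dphi x)) -> (forall x, continuous dphi x) ->
  (forall s, continuous a s) -> (forall s, continuous w s) ->
  is_derive (fun p => RInt (fun s => phi (a s - p) * w s) 0 L) p
    (RInt (fun s => - dphi (a s - p) * w s) 0 L).
Proof.
  intros Hphi Hdphi Ha Hw.
  apply (is_derive_RInt_param_all (fun p s => phi (a s - p) * w s)
           (fun p s => - dphi (a s - p) * w s)).
  - intros u s. apply is_derive_mult_const_r.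
    evar_last.
    + apply (is_derive_comp phi (fun u => a s - u)); [apply Hphi |].
      apply (is_derive_minus (fun _ => a s) (fun u => u)); [apply (is_derive_const (a s)) | apply is_derive_id].
    + unfold scal, minus, plus, opp, zero, one; simpl; unfold mult; simpl. ring.
  - intros s. apply continuity_2d_pt_mult.
    + apply continuity_2d_pt_opp, continuity_1d_2d_pt_comp.
      * apply continuity_pt_filterlim, Hdphi.
      * apply (continuity_2d_pt_minus (fun _ s => a s) (fun u _ => u)).
        -- apply continuity_2d_pt_comp2, continuity_pt_filterlim, Ha.
        -- apply continuity_2d_pt_id1.
    + apply continuity_2d_pt_comp2, continuity_pt_filterlim, Hw.
  - intros u s. apply (continuous_mult (fun s => phi (a s - u)) w); [| apply Hw].
    apply (continuous_comp (fun s => a s - u) phi).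
    + apply (continuous_minus a (fun _ => u)); [apply Ha | apply continuous_const].
    + apply (ex_derive_continuous phi). exists (dphi (a s - u)). apply Hphi.
Qed.

(* The mollification of the winding number of the curve [(a1, a2)], [b1 = a1'], around [(p1, p2)]
   by the bump [psi (x) psi (y)]: up to sign it is the integral along the curve of the
   pull-back of the 1-form [psi x * Psi y dx]. *)
Definition winding (L : R) (a1 a2 b1 Psi psi : R -> R) (p1 p2 : R) : R :=
  - RInt (fun s => psi (a1 s - p1) * Psi (a2 s - p2) * b1 s) 0 L.

Lemma is_derive_shifted (f g : R -> R) (x df dg : R) (p : R) :
  is_derive f (g x - p) df -> is_derive g x dg ->
  is_derive (fun x => f (g x - p)) x (df * dg).
Proof.
  intros Hf Hg. evar_last.
  - apply (is_derive_comp f (fun x => g x - p)); [exact Hf |].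
    apply (is_derive_minus g (fun _ => p)); [exact Hg | apply (is_derive_const p)].
  - unfold scal, minus, plus, opp, zero; simpl; unfold mult; simpl. ring.
Qed.

Lemma is_derive_reflected (f g : R -> R) (x df dg : R) (p : R) :
  is_derive f (p - g x) df -> is_derive g x dg ->
  is_derive (fun x => f (p - g x)) x (- df * dg).
Proof.
  intros Hf Hg. evar_last.
  - apply (is_derive_comp f (fun x => p - g x)); [exact Hf |].
    apply (is_derive_minus (fun _ => p) g); [apply (is_derive_const p) | exact Hg].
  - unfold scal, minus, plus, opp, zero; simpl; unfold mult; simpl. ring.
Qed.

Lemma is_derive_prod (f g : R -> R) (x df dg : R) :
  is_derive f x df -> is_derive g x dg ->
  is_derive (fun x => f x * g x) x (df * g x + f x * dg).
Proof. intros Hf Hg. exact (is_derive_mult f g x df dg Hf Hg Rmult_comm). Qed.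

Lemma is_derive_continuous (f : R -> R) (x df : R) : is_derive f x df -> continuous f x.
Proof. intros H. apply (ex_derive_continuous f). now exists df. Qed.

Lemma continuity_2d_pt_path (f a g : R -> R) (x s : R) :
  (forall y, continuous f y) -> continuous a s -> continuous g x ->
  continuity_2d_pt (fun u s => f (a s - g u)) x s.
Proof.
  intros Hf Ha Hg. apply continuity_1d_2d_pt_comp.
  - apply continuity_pt_filterlim, Hf.
  - apply (continuity_2d_pt_minus (fun _ s => a s) (fun u _ => g u)).
    + now apply continuity_2d_pt_comp2, continuity_pt_filterlim.
    + now apply continuity_2d_pt_comp1, continuity_pt_filterlim.
Qed.

(* Differentiating under the integral, the term in [dpsi] is integrated by parts along the curve. *)
Lemma is_derive_winding L a1 a2 b1 b2 c1 c2 d Psi2 Psi psi dpsi (g1 g2 h1 h2 : R -> R) (x : R) :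
  unit_speed_curve L a1 a2 b1 b2 c1 c2 -> bump d Psi2 Psi psi dpsi ->
  (forall u, is_derive g1 u (h1 u)) -> (forall u, is_derive g2 u (h2 u)) ->
  (forall u, continuous h1 u) -> (forall u, continuous h2 u) ->
  is_derive (fun u => winding L a1 a2 b1 Psi psi (g1 u) (g2 u)) x
    (RInt (fun s => psi (a1 s - g1 x) * psi (a2 s - g2 x) * (h2 x * b1 s - h1 x * b2 s)) 0 L).
Proof.
  intros C B Hg1 Hg2 Hh1 Hh2.
  assert (DP := bump_Psi _ _ _ _ _ B). assert (Dp := bump_psi _ _ _ _ _ B).
  assert (D1 := usc_a1 _ _ _ _ _ _ _ C). assert (D2 := usc_a2 _ _ _ _ _ _ _ C).
  assert (D3 := usc_b1 _ _ _ _ _ _ _ C). assert (D4 := usc_b2 _ _ _ _ _ _ _ C).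
  assert (CP : forall y, continuous Psi y) by exact (fun y => is_derive_continuous _ _ _ (DP y)).
  assert (Cp : forall y, continuous psi y) by exact (fun y => is_derive_continuous _ _ _ (Dp y)).
  assert (Cd : forall y, continuous dpsi y) by exact (bump_dpsi _ _ _ _ _ B).
  assert (C1 : forall y, continuous a1 y) by exact (fun y => is_derive_continuous _ _ _ (D1 y)).
  assert (C2 : forall y, continuous a2 y) by exact (fun y => is_derive_continuous _ _ _ (D2 y)).
  assert (C3 : forall y, continuous b1 y) by exact (fun y => is_derive_continuous _ _ _ (D3 y)).
  assert (C4 : forall y, continuous b2 y) by exact (fun y => is_derive_continuous _ _ _ (D4 y)).
  assert (Cg1 : forall y, continuous g1 y) by exact (fun y => is_derive_continuous _ _ _ (Hg1 y)).
  assert (Cg2 : forall y, continuous g2 y) by exact (fun y => is_derive_continuous _ _ _ (Hg2 y)).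
  assert (Csh : forall f a p s, (forall y, continuous f y) -> (forall y, continuous a y) ->
            continuous (fun s : R => f (a s - p) : R) s).
  { intros f a p s Hf Ha. apply (continuous_comp (fun s => a s - p) f); [| apply Hf].
    apply (continuous_minus a (fun _ => p)); [apply Ha | apply continuous_const]. }
  set (df := fun u s : R => (- dpsi (a1 s - g1 u) * h1 u * Psi (a2 s - g2 u)
               + psi (a1 s - g1 u) * (- psi (a2 s - g2 u) * h2 u)) * b1 s).
  assert (D : is_derive (fun u => RInt (fun s => psi (a1 s - g1 u) * Psi (a2 s - g2 u) * b1 s) 0 L)
                x (RInt (fun s => df x s) 0 L)).
  { apply (is_derive_RInt_param_all
             (fun u s => psi (a1 s - g1 u) * Psi (a2 s - g2 u) * b1 s) df).
    - intros u s. apply is_derive_mult_const_r.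
      apply (is_derive_prod (fun u => psi (a1 s - g1 u)) (fun u => Psi (a2 s - g2 u))).
      + exact (is_derive_reflected psi g1 u _ _ (a1 s) (Dp _) (Hg1 u)).
      + exact (is_derive_reflected Psi g2 u _ _ (a2 s) (DP _) (Hg2 u)).
    - intros s. unfold df.
      apply continuity_2d_pt_mult; [| apply continuity_2d_pt_comp2, continuity_pt_filterlim, C3].
      apply continuity_2d_pt_plus; apply continuity_2d_pt_mult.
      + apply continuity_2d_pt_mult.
        * apply continuity_2d_pt_opp. now apply continuity_2d_pt_path.
        * apply continuity_2d_pt_comp1, continuity_pt_filterlim, Hh1.
      + now apply continuity_2d_pt_path.
      + now apply continuity_2d_pt_path.
      + apply continuity_2d_pt_mult.
        * apply continuity_2d_pt_opp. now apply continuity_2d_pt_path.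
        * apply continuity_2d_pt_comp1, continuity_pt_filterlim, Hh2.
    - intros u s.
      apply (continuous_mult (fun s => psi (a1 s - g1 u) * Psi (a2 s - g2 u)) b1); [| apply C3].
      apply (continuous_mult (fun s => psi (a1 s - g1 u)) (fun s => Psi (a2 s - g2 u)));
        now apply Csh. }
  unfold winding.
  evar_last; [apply (is_derive_opp (fun u => RInt (fun s => psi (a1 s - g1 u) * Psi (a2 s - g2 u) * b1 s) 0 L)); exact D |].
  symmetry. apply is_RInt_unique.
  set (p1 := g1 x) in *. set (p2 := g2 x) in *.
  set (q := fun s => dpsi (a1 s - p1) * b1 s * Psi (a2 s - p2)
                     + psi (a1 s - p1) * (psi (a2 s - p2) * b2 s)).
  assert (Iq : is_RInt q 0 L 0).
  { apply (is_RInt_periodic_derive (fun s => psi (a1 s - p1) * Psi (a2 s - p2))).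
    - intros s. apply (is_derive_prod (fun s => psi (a1 s - p1)) (fun s => Psi (a2 s - p2))).
      + exact (is_derive_shifted psi a1 s _ _ p1 (Dp _) (D1 s)).
      + exact (is_derive_shifted Psi a2 s _ _ p2 (DP _) (D2 s)).
    - intros s. unfold q.
      apply (continuous_plus (fun s => dpsi (a1 s - p1) * b1 s * Psi (a2 s - p2))
                             (fun s => psi (a1 s - p1) * (psi (a2 s - p2) * b2 s))).
      + apply (continuous_mult (fun s => dpsi (a1 s - p1) * b1 s) (fun s => Psi (a2 s - p2)));
          [apply (continuous_mult (fun s => dpsi (a1 s - p1)) b1) |]; auto.
      + apply (continuous_mult (fun s => psi (a1 s - p1)) (fun s => psi (a2 s - p2) * b2 s));
          [| apply (continuous_mult (fun s => psi (a2 s - p2)) b2)]; auto.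
    - replace L with (0 + L) at 1 2 by ring.
      now rewrite (usc_a1L _ _ _ _ _ _ _ C), (usc_a2L _ _ _ _ _ _ _ C). }
  assert (Id : is_RInt (fun s => df x s) 0 L (RInt (fun s => df x s) 0 L)).
  { apply (RInt_correct (fun s => df x s)). apply (ex_RInt_continuous (fun s => df x s)).
    intros s _. unfold df. fold p1 p2.
    apply (continuous_mult (fun s => - dpsi (a1 s - p1) * h1 x * Psi (a2 s - p2)
               + psi (a1 s - p1) * (- psi (a2 s - p2) * h2 x)) b1); [| apply C3].
    apply (continuous_plus (fun s => - dpsi (a1 s - p1) * h1 x * Psi (a2 s - p2))
             (fun s => psi (a1 s - p1) * (- psi (a2 s - p2) * h2 x))).
    - apply (continuous_mult (fun s => - dpsi (a1 s - p1) * h1 x) (fun s => Psi (a2 s - p2))); [| auto].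
      apply (continuous_mult (fun s => - dpsi (a1 s - p1)) (fun s => h1 x)); [| apply continuous_const].
      apply (continuous_opp (fun s => dpsi (a1 s - p1))). auto.
    - apply (continuous_mult (fun s => psi (a1 s - p1)) (fun s => - psi (a2 s - p2) * h2 x)); [auto |].
      apply (continuous_mult (fun s => - psi (a2 s - p2)) (fun s => h2 x)); [| apply continuous_const].
      apply (continuous_opp (fun s => psi (a2 s - p2))). auto. }
  assert (I := is_RInt_minus _ _ 0 L _ _ (is_RInt_opp _ 0 L _ Id) (is_RInt_scal _ 0 L (h1 x) _ Iq)).
  evar_last; [eapply is_RInt_ext; [| exact I] |].
  - intros s _. unfold minus, plus, opp, scal; simpl; unfold mult; simpl.
    unfold df, q. fold p1 p2. ring.
  - unfold minus, plus, opp, scal; simpl; unfold mult; simpl. ring.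
Qed.

Definition psi_vanishes (a1 a2 psi : R -> R) (p1 p2 : R) : Prop :=
  forall s, psi (a1 s - p1) * psi (a2 s - p2) = 0.

Lemma winding_const L a1 a2 b1 b2 c1 c2 d Psi2 Psi psi dpsi (g1 g2 h1 h2 : R -> R) (x y : R) :
  unit_speed_curve L a1 a2 b1 b2 c1 c2 -> bump d Psi2 Psi psi dpsi ->
  (forall u, is_derive g1 u (h1 u)) -> (forall u, is_derive g2 u (h2 u)) ->
  (forall u, continuous h1 u) -> (forall u, continuous h2 u) ->
  (forall u, Rmin x y <= u <= Rmax x y -> psi_vanishes a1 a2 psi (g1 u) (g2 u)) ->
  winding L a1 a2 b1 Psi psi (g1 x) (g2 x) = winding L a1 a2 b1 Psi psi (g1 y) (g2 y).
Proof.
  intros C B Hg1 Hg2 Hh1 Hh2 Hv.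
  assert (D := fun u => is_derive_winding _ _ _ _ _ _ _ _ _ _ _ _ g1 g2 h1 h2 u C B Hg1 Hg2 Hh1 Hh2).
  destruct (MVT_gen (fun u => winding L a1 a2 b1 Psi psi (g1 u) (g2 u)) x y _
    (fun u _ => D u) (fun u _ => is_derive_continuity_pt _ _ _ (D u))) as [z [Hz E]].
  specialize (Hv z Hz).
  rewrite (is_RInt_unique _ 0 L 0) in E; [lra |].
  apply (is_RInt_ext (fun _ => 0)).
  - intros s _. now rewrite Hv, Rmult_0_l.
  - evar_last; [apply is_RInt_const |]. unfold scal; simpl; unfold mult; simpl; ring.
Qed.

(** [h2 u * b1 s - h1 u * b2 s] is the component of the path's velocity along the normal at
    [alpha s]; its sign matters only at the points of the curve that the bump sees. *)
Lemma winding_incr L a1 a2 b1 b2 c1 c2 d Psi2 Psi psi dpsi (g1 g2 h1 h2 : R -> R) (x y : R) :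
  unit_speed_curve L a1 a2 b1 b2 c1 c2 -> bump d Psi2 Psi psi dpsi ->
  (forall u, is_derive g1 u (h1 u)) -> (forall u, is_derive g2 u (h2 u)) ->
  (forall u, continuous h1 u) -> (forall u, continuous h2 u) ->
  x <= y ->
  (forall u s, x <= u <= y -> psi (a1 s - g1 u) * psi (a2 s - g2 u) = 0 \/
                0 <= h2 u * b1 s - h1 u * b2 s) ->
  winding L a1 a2 b1 Psi psi (g1 x) (g2 x) <= winding L a1 a2 b1 Psi psi (g1 y) (g2 y).
Proof.
  intros C B Hg1 Hg2 Hh1 Hh2 Hxy Hv.
  assert (D := fun u => is_derive_winding _ _ _ _ _ _ _ _ _ _ _ _ g1 g2 h1 h2 u C B Hg1 Hg2 Hh1 Hh2).
  destruct (MVT_gen (fun u => winding L a1 a2 b1 Psi psi (g1 u) (g2 u)) x y _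
    (fun u _ => D u) (fun u _ => is_derive_continuity_pt _ _ _ (D u))) as [z [Hz E]].
  rewrite Rmin_left, Rmax_right in Hz by lra.
  assert (DP := bump_Psi _ _ _ _ _ B). assert (Dp := bump_psi _ _ _ _ _ B).
  assert (D1 := usc_a1 _ _ _ _ _ _ _ C). assert (D2 := usc_a2 _ _ _ _ _ _ _ C).
  assert (D3 := usc_b1 _ _ _ _ _ _ _ C). assert (D4 := usc_b2 _ _ _ _ _ _ _ C).
  set (I := RInt _ 0 L) in E.
  assert (HI : 0 <= I).
  { apply RInt_ge_0.
    - apply Rlt_le, (usc_L _ _ _ _ _ _ _ C).
    - apply (ex_RInt_continuous (fun s => psi (a1 s - g1 z) * psi (a2 s - g2 z) * (h2 z * b1 s - h1 z * b2 s))).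
      intros s _. eapply is_derive_continuous.
      apply (is_derive_prod (fun s => psi (a1 s - g1 z) * psi (a2 s - g2 z)) (fun s => h2 z * b1 s - h1 z * b2 s)).
      + apply (is_derive_prod (fun s => psi (a1 s - g1 z)) (fun s => psi (a2 s - g2 z))).
        * exact (is_derive_shifted psi a1 s _ _ (g1 z) (Dp _) (D1 s)).
        * exact (is_derive_shifted psi a2 s _ _ (g2 z) (Dp _) (D2 s)).
      + apply (is_derive_minus (fun s => h2 z * b1 s) (fun s => h1 z * b2 s));
          [apply (is_derive_scal b1), D3 | apply (is_derive_scal b2), D4].
    - intros s _. destruct (Hv z s Hz) as [-> | h]; [lra |].
      apply Rmult_le_pos; [apply Rmult_le_pos; apply (bump_ge0 _ _ _ _ _ B) | exact h]. }
  nra.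
Qed.

(** Explicit antiderivatives take the place of Fubini: [Psi2] in [p2], then [Psi] in [p1]. They
    vanish at the upper limits, and the lower limits leave [a2 s + M + c] and 1. The constant
    [M + c] drops out since [b1] integrates to 0 over a period. *)
Lemma winding_integral L a1 a2 b1 b2 c1 c2 d Psi2 Psi psi dpsi (M : R) :
  unit_speed_curve L a1 a2 b1 b2 c1 c2 -> bump d Psi2 Psi psi dpsi ->
  (forall s, Rabs (a1 s) + d <= M) -> (forall s, Rabs (a2 s) + d <= M) ->
  exists V : R -> R,
    (forall p1, is_RInt (fun p2 => winding L a1 a2 b1 Psi psi p1 p2) (- M) M (V p1)) /\
    is_RInt V (- M) M (- RInt (fun s => a2 s * b1 s) 0 L).
Proof.
  intros C B M1 M2. destruct (bump_right2 _ _ _ _ _ B) as [c Hc].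
  assert (DP := bump_Psi _ _ _ _ _ B). assert (Dp := bump_psi _ _ _ _ _ B).
  assert (D1 := usc_a1 _ _ _ _ _ _ _ C). assert (D2 := usc_a2 _ _ _ _ _ _ _ C).
  assert (D3 := usc_b1 _ _ _ _ _ _ _ C). assert (D4 := usc_b2 _ _ _ _ _ _ _ C).
  assert (CP : forall y, continuous Psi y) by exact (fun y => is_derive_continuous _ _ _ (DP y)).
  assert (Cp : forall y, continuous psi y) by exact (fun y => is_derive_continuous _ _ _ (Dp y)).
  assert (C1 : forall y, continuous a1 y) by exact (fun y => is_derive_continuous _ _ _ (D1 y)).
  assert (C2 : forall y, continuous a2 y) by exact (fun y => is_derive_continuous _ _ _ (D2 y)).
  assert (C3 : forall y, continuous b1 y) by exact (fun y => is_derive_continuous _ _ _ (D3 y)).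
  assert (Z : forall s, - M <= a1 s - d /\ a1 s + d <= M /\ - M <= a2 s - d /\ a2 s + d <= M).
  { intros s. specialize (M1 s). specialize (M2 s).
    assert (X1 := Rle_abs (a1 s)). assert (X2 := Rle_abs (- a1 s)). rewrite Rabs_Ropp in X2.
    assert (X3 := Rle_abs (a2 s)). assert (X4 := Rle_abs (- a2 s)). rewrite Rabs_Ropp in X4.
    lra. }
  set (w := fun s => (a2 s + M + c) * b1 s).
  assert (Cw : forall s, continuous w s).
  { intros s. unfold w. apply (continuous_mult (fun s => a2 s + M + c) b1); [| apply C3].
    apply (continuous_plus (fun s => a2 s + M) (fun _ => c)); [| apply continuous_const].
    apply (continuous_plus a2 (fun _ => M)); [apply C2 | apply continuous_const]. }
  set (V := fun p1 => RInt (fun s => - psi (a1 s - p1) * w s) 0 L).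
  exists V. split.
  - intros p1. set (w1 := fun s => psi (a1 s - p1) * b1 s).
    assert (Cw1 : forall s, continuous w1 s).
    { intros s. eapply is_derive_continuous.
      apply (is_derive_prod (fun s => psi (a1 s - p1)) b1); [| apply D3].
      exact (is_derive_shifted psi a1 s _ _ p1 (Dp _) (D1 s)). }
    set (G := fun p2 => RInt (fun s => Psi2 (a2 s - p2) * w1 s) 0 L).
    evar_last; [apply (is_RInt_FTC G) |].
    + intros p2. evar_last; [apply (is_derive_RInt_shift Psi2 Psi a2 w1); auto; apply (bump_Psi2 _ _ _ _ _ B) |].
      unfold winding.
      assert (X : ex_RInt (fun s => psi (a1 s - p1) * Psi (a2 s - p2) * b1 s) 0 L).
      { apply (ex_RInt_continuous (fun s => psi (a1 s - p1) * Psi (a2 s - p2) * b1 s)).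
        intros s _. eapply is_derive_continuous.
        apply (is_derive_prod (fun s => psi (a1 s - p1) * Psi (a2 s - p2)) b1); [| apply D3].
        apply (is_derive_prod (fun s => psi (a1 s - p1)) (fun s => Psi (a2 s - p2))).
        - exact (is_derive_shifted psi a1 s _ _ p1 (Dp _) (D1 s)).
        - exact (is_derive_shifted Psi a2 s _ _ p2 (DP _) (D2 s)). }
      rewrite <- (RInt_Ropp _ 0 L X).
      apply RInt_Rext. intros s. unfold w1. ring.
    + intros p2. eapply is_derive_continuous.
      apply (is_derive_winding L a1 a2 b1 b2 c1 c2 d Psi2 Psi psi dpsi (fun _ => p1) (fun u => u)
               (fun _ => 0) (fun _ => 1) p2 C B).
      * intros; apply (is_derive_const p1).
      * intros u; exact (is_derive_id u).
      * intros; apply continuous_const.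
      * intros; apply continuous_const.
    + unfold G, V.
      rewrite (RInt_Rext (fun s => Psi2 (a2 s - M) * w1 s) (fun _ => 0)).
      * rewrite RInt_const, (RInt_Rext (fun s => Psi2 (a2 s - - M) * w1 s)
          (fun s => - (- psi (a1 s - p1) * w s))).
        -- rewrite RInt_Ropp.
           ++ unfold scal; simpl; unfold mult; simpl. ring.
           ++ apply (ex_RInt_continuous (fun s => - psi (a1 s - p1) * w s)). intros s _.
              apply (continuous_mult (fun s => - psi (a1 s - p1)) w); [| apply Cw].
              apply (continuous_opp (fun s => psi (a1 s - p1))).
              exact (is_derive_continuous _ _ _ (is_derive_shifted psi a1 s _ _ p1 (Dp _) (D1 s))).
        -- intros s. rewrite Hc by (specialize (Z s); lra).
           unfold w1, w. ring.
      * intros s. rewrite (bump_left2 _ _ _ _ _ B) by (specialize (Z s); lra).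
        apply Rmult_0_l.
  - set (H := fun p1 => RInt (fun s => Psi (a1 s - p1) * w s) 0 L).
    assert (DV : forall p, is_derive V p (RInt (fun s => - - dpsi (a1 s - p) * w s) 0 L)).
    { intros p.
      apply (is_derive_RInt_shift (fun x => - psi x) (fun x => - dpsi x) a1 w); auto.
      - intros x. apply (is_derive_opp psi). apply Dp.
      - intros x. apply (continuous_opp dpsi). apply (bump_dpsi _ _ _ _ _ B). }
    evar_last; [apply (is_RInt_FTC H) |].
    + intros p. apply (is_derive_RInt_shift Psi psi a1 w); auto.
    + intros p. eapply is_derive_continuous, DV.
    + unfold H.
      rewrite (RInt_Rext (fun s => Psi (a1 s - M) * w s) (fun _ => 0)).
      * rewrite RInt_const, (RInt_Rext (fun s => Psi (a1 s - - M) * w s)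
          (fun s => a2 s * b1 s + (M + c) * b1 s)).
        -- rewrite (is_RInt_unique _ 0 L (RInt (fun s => a2 s * b1 s) 0 L + (M + c) * 0)).
           ++ unfold scal; simpl; unfold mult; simpl. ring.
           ++ apply (is_RInt_plus (fun s => a2 s * b1 s) (fun s => (M + c) * b1 s)).
              ** apply (RInt_correct (fun s => a2 s * b1 s)).
                 apply (ex_RInt_continuous (fun s => a2 s * b1 s)). intros s _.
                 apply (continuous_mult a2 b1); auto.
              ** apply (is_RInt_scal b1). apply (is_RInt_periodic_derive a1); [apply D1 | apply C3 |].
                 rewrite <- (usc_a1L _ _ _ _ _ _ _ C 0). f_equal. ring.
        -- intros s. rewrite (bump_right _ _ _ _ _ B) by (specialize (Z s); lra).
           unfold w. ring.
      * intros s. rewrite (bump_left _ _ _ _ _ B) by (specialize (Z s); lra).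
        apply Rmult_0_l.
Qed.

(** * Values of the mollified winding number *)

(** Only [r ^ 2] enters, so a signed normal coordinate can be used directly as the distance. *)
Definition far (a1 a2 : R -> R) (p1 p2 r : R) : Prop :=
  forall s, r ^ 2 <= (a1 s - p1) ^ 2 + (a2 s - p2) ^ 2.

(** The product bump lives in a square of half-side [d], hence in a disc of radius
    [sqrt 2 d < 2 d]. *)
Lemma far_vanishes (a1 a2 : R -> R) d Psi2 Psi psi dpsi (p1 p2 r : R) :
  bump d Psi2 Psi psi dpsi -> 0 < d -> 2 * d <= Rabs r ->
  far a1 a2 p1 p2 r -> psi_vanishes a1 a2 psi p1 p2.
Proof.
  intros B Hd Hr Hf s. specialize (Hf s).
  destruct (Rle_lt_dec d (Rabs (a1 s - p1))) as [h | h].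
  - rewrite (bump_supp _ _ _ _ _ B _ h). ring.
  - destruct (Rle_lt_dec d (Rabs (a2 s - p2))) as [h' | h'].
    + rewrite (bump_supp _ _ _ _ _ B _ h'). ring.
    + exfalso. rewrite <- (pow2_abs r), <- (pow2_abs (a1 s - p1)), <- (pow2_abs (a2 s - p2)) in Hf.
      assert (X1 := Rabs_pos (a1 s - p1)). assert (X2 := Rabs_pos (a2 s - p2)). nra.
Qed.

(** After expanding the square, [r ^ 2] cancels because the normal is a unit vector; what remains is
    affine in [r]. *)
Lemma far_normal_iff L a1 a2 b1 b2 c1 c2 : unit_speed_curve L a1 a2 b1 b2 c1 c2 ->
  forall s0 r, far a1 a2 (a1 s0 - r * b2 s0) (a2 s0 + r * b1 s0) r <->
  forall s, 2 * r * (- (a1 s - a1 s0) * b2 s0 + (a2 s - a2 s0) * b1 s0)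
            <= (a1 s - a1 s0) ^ 2 + (a2 s - a2 s0) ^ 2.
Proof.
  intros C s0 r. assert (U := usc_unit _ _ _ _ _ _ _ C s0).
  assert (E : forall s, (a1 s - (a1 s0 - r * b2 s0)) ^ 2 + (a2 s - (a2 s0 + r * b1 s0)) ^ 2 =
    (a1 s - a1 s0) ^ 2 + (a2 s - a2 s0) ^ 2
    - 2 * r * (- (a1 s - a1 s0) * b2 s0 + (a2 s - a2 s0) * b1 s0) + r ^ 2).
  { intros s. replace (r ^ 2) with (r ^ 2 * (b1 s0 ^ 2 + b2 s0 ^ 2)) by (rewrite U; ring). ring. }
  split; intros H s; specialize (H s); [rewrite E in H | rewrite E]; lra.
Qed.

(** The smaller of two discs tangent at the same point on the same side lies in the larger. In the
    affine form, a condition true at 0 and at [D] holds in between. *)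
Lemma far_normal_segment L a1 a2 b1 b2 c1 c2 : unit_speed_curve L a1 a2 b1 b2 c1 c2 ->
  forall s0 D r, far a1 a2 (a1 s0 - D * b2 s0) (a2 s0 + D * b1 s0) D ->
  0 <= r <= D \/ D <= r <= 0 ->
  far a1 a2 (a1 s0 - r * b2 s0) (a2 s0 + r * b1 s0) r.
Proof.
  intros C s0 D r Hf Hr.
  apply (far_normal_iff _ _ _ _ _ _ _ C). intros s.
  apply (proj1 (far_normal_iff _ _ _ _ _ _ _ C s0 D)) with (s := s) in Hf.
  set (N := - (a1 s - a1 s0) * b2 s0 + (a2 s - a2 s0) * b1 s0) in *.
  assert (Q : 0 <= (a1 s - a1 s0) ^ 2 + (a2 s - a2 s0) ^ 2)
    by (assert (Z1 := pow2_ge_0 (a1 s - a1 s0)); assert (Z2 := pow2_ge_0 (a2 s - a2 s0)); lra).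
  set (X := (a1 s - a1 s0) ^ 2 + (a2 s - a2 s0) ^ 2) in *.
  destruct (Rle_lt_dec N 0), Hr; nra.
Qed.

(** The curve has reach at least [rho]: up to that distance, [alpha s] is a nearest point for the
    points of its own normal. *)
Definition tube (a1 a2 b1 b2 : R -> R) (rho : R) : Prop :=
  forall s r, Rabs r <= rho -> far a1 a2 (a1 s - r * b2 s) (a2 s + r * b1 s) r.

Lemma tube_exists L a1 a2 b1 b2 c1 c2 : unit_speed_curve L a1 a2 b1 b2 c1 c2 ->
  exists rho, 0 < rho /\ tube a1 a2 b1 b2 rho.
Proof.
  intros C. destruct (tangent_circle _ _ _ _ _ _ _ C) as [rho [Hrho T]].
  exists rho. split; [exact Hrho |]. intros s r Hr.
  apply (far_normal_iff _ _ _ _ _ _ _ C). intros s'. now apply T.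
Qed.

(** The path is the parallel curve itself, all of whose points have distance at least [2 d] from the
    curve. *)
Lemma winding_parallel L a1 a2 b1 b2 c1 c2 d Psi2 Psi psi dpsi (rho r s s' : R) :
  unit_speed_curve L a1 a2 b1 b2 c1 c2 -> bump d Psi2 Psi psi dpsi -> 0 < d ->
  tube a1 a2 b1 b2 rho -> 2 * d <= Rabs r <= rho ->
  winding L a1 a2 b1 Psi psi (a1 s - r * b2 s) (a2 s + r * b1 s) =
  winding L a1 a2 b1 Psi psi (a1 s' - r * b2 s') (a2 s' + r * b1 s').
Proof.
  intros C B Hd T Hr.
  apply (winding_const L a1 a2 b1 b2 c1 c2 d Psi2 Psi psi dpsi
    (fun u => a1 u - r * b2 u) (fun u => a2 u + r * b1 u)
    (fun u => b1 u - r * c2 u) (fun u => b2 u + r * c1 u) s s' C B).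
  - intros u. apply (is_derive_minus a1 (fun u => r * b2 u));
      [apply (usc_a1 _ _ _ _ _ _ _ C) | apply (is_derive_scal b2), (usc_b2 _ _ _ _ _ _ _ C)].
  - intros u. apply (is_derive_plus a2 (fun u => r * b1 u));
      [apply (usc_a2 _ _ _ _ _ _ _ C) | apply (is_derive_scal b1), (usc_b1 _ _ _ _ _ _ _ C)].
  - intros u. apply (continuous_minus b1 (fun u => r * c2 u)).
    + exact (is_derive_continuous _ _ _ (usc_b1 _ _ _ _ _ _ _ C u)).
    + apply (continuous_scal_r r c2), (usc_c2 _ _ _ _ _ _ _ C).
  - intros u. apply (continuous_plus b2 (fun u => r * c1 u)).
    + exact (is_derive_continuous _ _ _ (usc_b2 _ _ _ _ _ _ _ C u)).
    + apply (continuous_scal_r r c1), (usc_c1 _ _ _ _ _ _ _ C).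
  - intros u _. apply (far_vanishes a1 a2 d Psi2 Psi psi dpsi _ _ r B Hd); [lra |].
    apply T; lra.
Qed.

Lemma is_derive_affine (p v x : R) : is_derive (fun u => p + u * v) x v.
Proof. auto_derive; [exact I | ring]. Qed.

Lemma is_derive_affine_opp (p v x : R) : is_derive (fun u => p - u * v) x (- v).
Proof. auto_derive; [exact I | ring]. Qed.

Lemma winding_normal_segment L a1 a2 b1 b2 c1 c2 d Psi2 Psi psi dpsi (s0 D r : R) :
  unit_speed_curve L a1 a2 b1 b2 c1 c2 -> bump d Psi2 Psi psi dpsi -> 0 < d ->
  far a1 a2 (a1 s0 - D * b2 s0) (a2 s0 + D * b1 s0) D ->
  2 * d <= r <= D \/ D <= r <= - (2 * d) ->
  winding L a1 a2 b1 Psi psi (a1 s0 - D * b2 s0) (a2 s0 + D * b1 s0) =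
  winding L a1 a2 b1 Psi psi (a1 s0 - r * b2 s0) (a2 s0 + r * b1 s0).
Proof.
  intros C B Hd Hf Hr.
  apply (winding_const L a1 a2 b1 b2 c1 c2 d Psi2 Psi psi dpsi
    (fun u => a1 s0 - u * b2 s0) (fun u => a2 s0 + u * b1 s0)
    (fun _ => - b2 s0) (fun _ => b1 s0) D r C B).
  - intros; apply is_derive_affine_opp.
  - intros; apply is_derive_affine.
  - intros; apply continuous_const.
  - intros; apply continuous_const.
  - intros u Hu.
    assert (Hu' : 2 * d <= u <= D \/ D <= u <= - (2 * d)).
    { destruct Hr; [rewrite Rmin_right, Rmax_left in Hu by lra
                   | rewrite Rmin_left, Rmax_right in Hu by lra]; lra. }
    apply (far_vanishes a1 a2 d Psi2 Psi psi dpsi _ _ u B Hd).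
    + destruct Hu'; [rewrite Rabs_pos_eq by lra | rewrite Rabs_left by lra]; lra.
    + apply (far_normal_segment _ _ _ _ _ _ _ C s0 D u Hf). destruct Hu'; lra.
Qed.

(** Lets the period start just before the lowest point, so that the arc through it is not cut in
    two. *)
Lemma is_RInt_period_shift (f : R -> R) (L c v : R) :
  (forall s, continuous f s) -> (forall s, f (s + L) = f s) ->
  is_RInt f c (c + L) v -> RInt f 0 L = v.
Proof.
  intros Hc HL Hv.
  set (F := fun x => RInt f 0 x).
  assert (DF : forall x, is_derive F x (f x)).
  { intros x. apply (is_derive_RInt f F 0); [| apply Hc].
    apply filter_forall. intros y. apply (RInt_correct f), (ex_RInt_continuous f). auto. }
  rewrite <- (is_RInt_unique _ _ _ _ Hv).
  rewrite (is_RInt_unique _ _ _ _ (is_RInt_FTC F f c (c + L) DF Hc)).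
  destruct (mean_value (fun x => F (x + L) - F x) (fun x => f (x + L) - f x) 0 c) as [z [_ E]].
  - intros z. apply (is_derive_minus (fun x => F (x + L)) F); [| apply DF].
    evar_last.
    + apply (is_derive_comp F (fun t => t + L) z); [apply DF |].
      auto_derive; [exact I | reflexivity].
    + unfold scal; simpl; unfold mult; simpl. ring.
  - rewrite HL, Rminus_diag, Rmult_0_l in E.
    rewrite Rplus_0_l in E. unfold F at 4 in E. rewrite RInt_point in E.
    change zero with 0 in E. unfold F in *. lra.
Qed.

(** With the whole curve above, [Psi] is constantly 1 on it, and the integrand becomes an exact
    derivative of a periodic function. *)
Lemma winding_below L a1 a2 b1 b2 c1 c2 d Psi2 Psi psi dpsi (p1 p2 : R) :
  unit_speed_curve L a1 a2 b1 b2 c1 c2 -> bump d Psi2 Psi psi dpsi ->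
  (forall s, p2 + d <= a2 s) -> winding L a1 a2 b1 Psi psi p1 p2 = 0.
Proof.
  intros C B Hp. unfold winding.
  rewrite (is_RInt_unique _ 0 L 0); [ring |].
  apply (is_RInt_ext (fun s => psi (a1 s - p1) * b1 s)).
  - intros s _. rewrite (bump_right _ _ _ _ _ B) by (specialize (Hp s); lra).
    apply Rmult_eq_compat_r. symmetry. apply Rmult_1_r.
  - apply (is_RInt_periodic_derive (fun s => Psi (a1 s - p1))).
    + intros s. exact (is_derive_shifted Psi a1 s _ _ p1 (bump_Psi _ _ _ _ _ B _) (usc_a1 _ _ _ _ _ _ _ C s)).
    + intros s. exact (is_derive_continuous _ _ _ (is_derive_prod _ _ _ _ _
        (is_derive_shifted psi a1 s _ _ p1 (bump_psi _ _ _ _ _ B _) (usc_a1 _ _ _ _ _ _ _ C s))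
        (usc_b1 _ _ _ _ _ _ _ C s))).
    + rewrite <- (usc_a1L _ _ _ _ _ _ _ C 0). do 2 f_equal. f_equal. ring.
Qed.

(* Just above a lowest point only the arc through it is seen from below, and it passes from
   left to right. *)
Lemma winding_above_bottom L a1 a2 b1 b2 c1 c2 d Psi2 Psi psi dpsi (eta m s0 : R) :
  unit_speed_curve L a1 a2 b1 b2 c1 c2 -> bump d Psi2 Psi psi dpsi -> 0 < d ->
  2 * d <= eta -> 2 * eta <= L ->
  (forall s s', Rabs (s' - s) <= eta -> 1 / 2 <= b1 s' * b1 s + b2 s' * b2 s) ->
  (forall s h, eta <= h <= L - eta -> m <= (a1 (s + h) - a1 s) ^ 2 + (a2 (s + h) - a2 s) ^ 2) ->
  100 * d ^ 2 <= m ->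
  (forall s, a2 s0 <= a2 s) -> b1 s0 = 1 -> b2 s0 = 0 ->
  winding L a1 a2 b1 Psi psi (a1 s0) (a2 s0 + 8 * d) = 1.
Proof.
  intros C B Hd Heta HetaL Ht Hm Hdm Hmin Hb1 Hb2.
  assert (D1 := usc_a1 _ _ _ _ _ _ _ C). assert (D2 := usc_a2 _ _ _ _ _ _ _ C).
  assert (D3 := usc_b1 _ _ _ _ _ _ _ C).
  assert (Dp := bump_psi _ _ _ _ _ B). assert (DP := bump_Psi _ _ _ _ _ B).
  set (p1 := a1 s0). set (p2 := a2 s0 + 8 * d).
  set (k := fun s => psi (a1 s - p1) * b1 s).
  set (g := fun s => psi (a1 s - p1) * Psi (a2 s - p2) * b1 s).
  assert (Ck : forall s, continuous k s).
  { intros s. exact (is_derive_continuous _ _ _ (is_derive_prod _ _ _ _ _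
      (is_derive_shifted psi a1 s _ _ p1 (Dp _) (D1 s)) (D3 s))). }
  assert (Cg : forall s, continuous g s).
  { intros s. exact (is_derive_continuous _ _ _ (is_derive_prod _ _ _ _ _ (is_derive_prod _ _ _ _ _
      (is_derive_shifted psi a1 s _ _ p1 (Dp _) (D1 s))
      (is_derive_shifted Psi a2 s _ _ p2 (DP _) (D2 s))) (D3 s))). }
  assert (DK : forall s, is_derive (fun s => Psi (a1 s - p1)) s (k s))
    by (intros s; exact (is_derive_shifted Psi a1 s _ _ p1 (DP _) (D1 s))).
  (* [k] integrates to 0 over the closed curve, so [Psi] may be replaced by [Psi - 1]: instead of
     the points above, the points below [p] are counted. *)
  set (f := fun s => k s - g s).
  assert (Cf : forall s, continuous f s)
    by (intros s; apply (continuous_minus k g); auto).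
  assert (Ik : is_RInt k 0 L 0).
  { apply (is_RInt_periodic_derive (fun s => Psi (a1 s - p1)) k L DK Ck).
    rewrite <- (usc_a1L _ _ _ _ _ _ _ C 0). do 2 f_equal. f_equal. ring. }
  assert (Ig : is_RInt g 0 L (RInt g 0 L))
    by (apply (RInt_correct g), (ex_RInt_continuous g); auto).
  assert (EW : winding L a1 a2 b1 Psi psi p1 p2 = RInt f 0 L).
  { unfold winding. fold g. symmetry. apply is_RInt_unique.
    replace (- RInt g 0 L) with (0 - RInt g 0 L) by ring.
    exact (is_RInt_minus k g 0 L _ _ Ik Ig). }
  rewrite EW. apply (is_RInt_period_shift f L (s0 - eta)); [exact Cf | |].
  { intros s. unfold f, k, g.
    now rewrite (usc_a1L _ _ _ _ _ _ _ C), (usc_a2L _ _ _ _ _ _ _ C), (usc_b1L _ _ _ _ _ _ _ C). }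
  assert (Hmv : forall s, Rabs (s - s0) <= eta ->
     exists z, 1 / 2 <= z /\ a1 s - a1 s0 = z * (s - s0)).
  { intros s Hs. destruct (displacement_mean_value _ _ _ _ _ _ _ C 1 0 s0 s) as [z [Hz Ez]].
    exists (b1 z). split; [| lra].
    specialize (Ht s0 z ltac:(lra)). rewrite Hb1, Hb2 in Ht. lra. }
  replace 1 with (1 + 0) by ring.
  apply (is_RInt_Chasles f (s0 - eta) (s0 + eta) (s0 - eta + L)).
  - apply (is_RInt_ext k).
    + intros s. rewrite Rmin_left, Rmax_right by lra. intros Hs.
      unfold f, g.
      destruct (Rle_lt_dec d (Rabs (a1 s - p1))) as [h | h].
      * rewrite (bump_supp _ _ _ _ _ B _ h). unfold k. rewrite (bump_supp _ _ _ _ _ B _ h).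
        rewrite !Rmult_0_l. symmetry. apply Rminus_0_r.
      (* Being within [d] horizontally forces [|s - s0| < 2 d], so the arc has risen by less than
         [2 d] and stays more than [d] below [p]. *)
      * rewrite (bump_left _ _ _ _ _ B), Rmult_0_r, Rmult_0_l; [symmetry; apply Rminus_0_r |].
        destruct (Hmv s) as [z [Hz Ez]]; [apply Rabs_le; lra |].
        fold p1 in Ez. rewrite Ez in h.
        rewrite Rabs_mult, (Rabs_pos_eq z) in h by lra.
        assert (Hs2 : Rabs (s - s0) < 2 * d) by (assert (Z := Rabs_pos (s - s0)); nra).
        destruct (displacement_mean_value _ _ _ _ _ _ _ C 0 1 s0 s) as [y [_ Ey]].
        destruct (unit_component_bound _ _ (usc_unit _ _ _ _ _ _ _ C y)) as [_ u2].
        assert (E2 : a2 s - a2 s0 = b2 y * (s - s0)) by lra.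
        assert (Rabs (a2 s - a2 s0) <= Rabs (s - s0)).
        { rewrite E2, Rabs_mult. assert (Z := Rabs_pos (s - s0)). nra. }
        assert (Z := Rle_abs (a2 s - a2 s0)). unfold p2. lra.
    + evar_last; [apply (is_RInt_FTC _ k _ _ DK Ck) |]. cbv beta.
      destruct (Hmv (s0 + eta)) as [z [Hz Ez]]; [rewrite Rabs_pos_eq; lra |].
      destruct (Hmv (s0 - eta)) as [y [Hy Ey]]; [rewrite Rabs_left; lra |].
      fold p1 in Ez, Ey. rewrite Ez, Ey.
      rewrite (bump_right _ _ _ _ _ B), (bump_left _ _ _ _ _ B) by nra. ring.
  - apply (is_RInt_ext (fun _ => 0)).
    + intros s. rewrite Rmin_left, Rmax_right by lra. intros Hs.
      unfold f, k, g.
      destruct (Rle_lt_dec d (Rabs (a1 s - p1))) as [h | h].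
      * rewrite (bump_supp _ _ _ _ _ B _ h). rewrite !Rmult_0_l. symmetry. apply Rminus_0_r.
      * destruct (Rle_lt_dec d (a2 s - p2)) as [h' | h'].
        -- rewrite (bump_right _ _ _ _ _ B _ h'), Rmult_1_r. symmetry. apply Rminus_diag.
        (* Such a point would have squared distance below [d^2 + (9 d)^2] from the lowest point,
           less than [100 d^2 <= m]. *)
        -- exfalso. specialize (Hm s0 (s - s0) ltac:(lra)).
           replace (s0 + (s - s0)) with s in Hm by ring. fold p1 in Hm.
           apply Rabs_def2 in h. specialize (Hmin s). unfold p2 in h'. nra.
    + evar_last; [apply is_RInt_const |]. unfold scal; simpl; unfold mult; simpl; ring.
Qed.

Lemma winding_values L a1 a2 b1 b2 c1 c2 (s0 : R) :
  unit_speed_curve L a1 a2 b1 b2 c1 c2 ->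
  (forall s, a2 s0 <= a2 s) -> b1 s0 = 1 ->
  exists d0, 0 < d0 /\ forall d Psi2 Psi psi dpsi, 0 < d <= d0 -> bump d Psi2 Psi psi dpsi ->
    (forall p1 p2, 0 <= winding L a1 a2 b1 Psi psi p1 p2) /\
    (forall s D, 8 * d <= D -> far a1 a2 (a1 s - D * b2 s) (a2 s + D * b1 s) D ->
       winding L a1 a2 b1 Psi psi (a1 s - D * b2 s) (a2 s + D * b1 s) = 1).
Proof.
  intros C Hmin Hb1.
  assert (HL := usc_L _ _ _ _ _ _ _ C).
  assert (Hb2 : b2 s0 = 0).
  { assert (U := usc_unit _ _ _ _ _ _ _ C s0). rewrite Hb1 in U.
    destruct (sum_sqr_le0 (b2 s0) 0); lra. }
  destruct (tube_exists _ _ _ _ _ _ _ C) as [rho [Hrho T]].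
  destruct (close_points_tangent _ _ _ _ _ _ _ C) as [m' [Hm' Hc]].
  destruct (near_tangent _ _ _ _ _ _ _ C) as [eta0 [Heta0 Ht0]].
  set (eta := Rmin eta0 (L / 2)).
  assert (Heta : 0 < eta) by (apply Rmin_pos; lra).
  assert (He1 : eta <= eta0) by apply Rmin_l.
  assert (He2 : eta <= L / 2) by apply Rmin_r.
  destruct (chord_bound _ _ _ _ _ _ _ eta C Heta) as [m [Hm Hmb]].
  (* [rho / 8] keeps the offsets [8 d] in the tube and [eta / 2] serves the arc at the lowest point.
     The bound 1 gives [d^2 <= d], whence [100 d^2 <= m] and [162 d^2 < m']. *)
  set (d0 := Rmin (Rmin (rho / 8) (eta / 2)) (Rmin 1 (Rmin (m / 200) (m' / 200)))).
  assert (X1 : d0 <= Rmin (rho / 8) (eta / 2)) by apply Rmin_l.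
  assert (X2 := Rmin_l (rho / 8) (eta / 2)). assert (X3 := Rmin_r (rho / 8) (eta / 2)).
  assert (X4 : d0 <= Rmin 1 (Rmin (m / 200) (m' / 200))) by apply Rmin_r.
  assert (X5 := Rmin_l 1 (Rmin (m / 200) (m' / 200))).
  assert (X6 := Rmin_r 1 (Rmin (m / 200) (m' / 200))).
  assert (X7 := Rmin_l (m / 200) (m' / 200)). assert (X8 := Rmin_r (m / 200) (m' / 200)).
  exists d0. split; [repeat apply Rmin_pos; lra |].
  intros d Psi2 Psi psi dpsi Hd B.
  assert (Hd2 : d ^ 2 <= d) by nra.
  (* At the lowest point the left normal points straight up, so the right-hand parallel curve
     contains a point [8 d] below the whole curve. *)
  assert (WR : forall s, winding L a1 a2 b1 Psi psi
            (a1 s - - (8 * d) * b2 s) (a2 s + - (8 * d) * b1 s) = 0).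
  { intros s.
    rewrite (winding_parallel L a1 a2 b1 b2 c1 c2 d Psi2 Psi psi dpsi rho (- (8 * d)) s s0 C B);
      [| lra | exact T | rewrite Rabs_left; lra].
    apply (winding_below L a1 a2 b1 b2 c1 c2 d Psi2 Psi psi dpsi _ _ C B).
    intros s'. specialize (Hmin s'). rewrite Hb1. lra. }
  assert (WL : forall s, winding L a1 a2 b1 Psi psi
            (a1 s - 8 * d * b2 s) (a2 s + 8 * d * b1 s) = 1).
  { intros s.
    rewrite (winding_parallel L a1 a2 b1 b2 c1 c2 d Psi2 Psi psi dpsi rho (8 * d) s s0 C B);
      [| lra | exact T | rewrite Rabs_pos_eq; lra].
    rewrite Hb1, Hb2, Rmult_0_r, Rmult_1_r, Rminus_0_r.
    apply (winding_above_bottom L a1 a2 b1 b2 c1 c2 d Psi2 Psi psi dpsi eta m s0 C B); auto; try lra.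
    intros s1 s2 h. apply Ht0. lra. }
  assert (WD : forall s D, 8 * d <= D -> far a1 a2 (a1 s - D * b2 s) (a2 s + D * b1 s) D ->
       winding L a1 a2 b1 Psi psi (a1 s - D * b2 s) (a2 s + D * b1 s) = 1).
  { intros s D HD Hf.
    rewrite (winding_normal_segment L a1 a2 b1 b2 c1 c2 d Psi2 Psi psi dpsi s D (8 * d) C B);
      [apply WL | lra | exact Hf | left; lra]. }
  split; [| exact WD].
  intros p1 p2.
  destruct (nearest_point _ _ _ _ _ _ _ p1 p2 C) as (s & D & -> & -> & Hf).
  destruct (Rle_lt_dec (8 * d) D) as [h | h]; [rewrite WD by assumption; lra |].
  destruct (Rle_lt_dec D (- (8 * d))) as [h' | h'].
  - rewrite (winding_normal_segment L a1 a2 b1 b2 c1 c2 d Psi2 Psi psi dpsi s D (- (8 * d)) C B);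
      [rewrite WR; lra | lra | exact Hf | right; lra].
  (* Closer than [8 d] to the curve no exact value is claimed; the normal leads here from the
     right-hand parallel curve, where the value is 0, and the value cannot decrease on the way. *)
  - rewrite <- (WR s).
    apply (winding_incr L a1 a2 b1 b2 c1 c2 d Psi2 Psi psi dpsi
      (fun u => a1 s - u * b2 s) (fun u => a2 s + u * b1 s)
      (fun _ => - b2 s) (fun _ => b1 s) (- (8 * d)) D C B).
    + intros; apply is_derive_affine_opp.
    + intros; apply is_derive_affine.
    + intros; apply continuous_const.
    + intros; apply continuous_const.
    + lra.
    + intros u s' Hu.
      destruct (Rle_lt_dec d (Rabs (a1 s' - (a1 s - u * b2 s)))) as [k1 | k1];
        [left; rewrite (bump_supp _ _ _ _ _ B _ k1); ring |].
      destruct (Rle_lt_dec d (Rabs (a2 s' - (a2 s + u * b1 s)))) as [k2 | k2];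
        [left; rewrite (bump_supp _ _ _ _ _ B _ k2); ring |].
      right.
      (* The bump sees only points within [d] of its centre in each coordinate, and the centre is
         within [8 d] of [alpha s]. Points that close have tangents forming no obtuse angle, which
         is the required sign. *)
      destruct (unit_component_bound _ _ (usc_unit _ _ _ _ _ _ _ C s)) as [u1 u2].
      assert (Hu' : Rabs u <= 8 * d) by (apply Rabs_le; lra).
      assert (V1 : Rabs (a1 s' - a1 s) < 9 * d).
      { replace (a1 s' - a1 s) with ((a1 s' - (a1 s - u * b2 s)) + - (u * b2 s)) by ring.
        eapply Rle_lt_trans; [apply Rabs_triang |]. rewrite Rabs_Ropp, Rabs_mult.
        assert (Z := Rabs_pos u). nra. }
      assert (V2 : Rabs (a2 s' - a2 s) < 9 * d).
      { replace (a2 s' - a2 s) with ((a2 s' - (a2 s + u * b1 s)) + u * b1 s) by ring.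
        eapply Rle_lt_trans; [apply Rabs_triang |]. rewrite Rabs_mult.
        assert (Z := Rabs_pos u). nra. }
      specialize (Hc s s').
      assert (Hc' : 0 <= b1 s' * b1 s + b2 s' * b2 s).
      { apply Hc. rewrite <- (pow2_abs (a1 s' - a1 s)), <- (pow2_abs (a2 s' - a2 s)).
        assert (Z1 := Rabs_pos (a1 s' - a1 s)). assert (Z2 := Rabs_pos (a2 s' - a2 s)). nra. }
      lra.
Qed.

(** * The enclosed domain and its area *)

Lemma far_not_onC (a1 a2 : R -> R) (p1 p2 r : R) :
  r <> 0 -> far a1 a2 p1 p2 r -> ~ onC a1 a2 (p1, p2).
Proof.
  intros Hr Hf [s E]. injection E as -> ->. specialize (Hf s).
  rewrite !Rminus_diag in Hf. apply pow2_gt_0 in Hr. lra.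
Qed.

Lemma inside_path (a1 a2 g1 g2 : R -> R) :
  (forall u, continuity_pt g1 u) -> (forall u, continuity_pt g2 u) ->
  inside a1 a2 (g1 0, g2 0) ->
  (forall u, 0 <= u <= 1 -> ~ onC a1 a2 (g1 u, g2 u)) ->
  inside a1 a2 (g1 1, g2 1).
Proof.
  intros H1 H2 [_ [Rb HR]] Hg. split; [apply Hg; lra |].
  exists Rb. intros k1 k2 K1 K2 E Hk u Hu. injection E as E1 E2.
  (* [lo u] is the minimum of [2 u] and 1, and [hi u] the maximum of [2 u - 1] and 0. Then
     [g (lo u) + k (hi u) - g 1] is the concatenation of the two paths, visibly continuous on all of
     [R]. *)
  set (lo := fun u : R => (2 * u + 1 - Rabs (2 * u - 1)) / 2).
  set (hi := fun u : R => (2 * u - 1 + Rabs (2 * u - 1)) / 2).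
  assert (Cabs : forall u, continuity_pt (fun u => Rabs (2 * u - 1)) u).
  { intros v. apply (continuity_pt_comp (fun u => 2 * u - 1) Rabs); [reg | apply Rcontinuity_abs]. }
  assert (Clo : forall u, continuity_pt lo u).
  { intros v. apply (continuity_pt_mult (fun u => 2 * u + 1 - Rabs (2 * u - 1)) (fun _ => / 2)); [| reg].
    apply (continuity_pt_minus (fun u => 2 * u + 1)); [reg | apply Cabs]. }
  assert (Chi : forall u, continuity_pt hi u).
  { intros v. apply (continuity_pt_mult (fun u => 2 * u - 1 + Rabs (2 * u - 1)) (fun _ => / 2)); [| reg].
    apply (continuity_pt_plus (fun u => 2 * u - 1)); [reg | apply Cabs]. }
  assert (Hlo : forall v, v <= 1 / 2 -> lo v = 2 * v /\ hi v = 0)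
    by (intros v hv; unfold lo, hi; rewrite Rabs_left1 by lra; split; field).
  assert (Hhi : forall v, 1 / 2 <= v -> lo v = 1 /\ hi v = 2 * v - 1)
    by (intros v hv; unfold lo, hi; rewrite Rabs_pos_eq by lra; split; field).
  set (f1 := fun u => g1 (lo u) + k1 (hi u) - g1 1).
  set (f2 := fun u => g2 (lo u) + k2 (hi u) - g2 1).
  assert (F1 : forall v, v <= 1 / 2 -> f1 v = g1 (2 * v) /\ f2 v = g2 (2 * v)).
  { intros v hv. unfold f1, f2. destruct (Hlo v hv) as [-> ->]. rewrite E1, E2. split; ring. }
  assert (F2 : forall v, 1 / 2 <= v -> f1 v = k1 (2 * v - 1) /\ f2 v = k2 (2 * v - 1)).
  { intros v hv. unfold f1, f2. destruct (Hhi v hv) as [-> ->]. split; ring. }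
  destruct (F2 ((u + 1) / 2)) as [X1 X2]; [lra |].
  replace (2 * ((u + 1) / 2) - 1) with u in X1, X2 by field.
  rewrite <- X1, <- X2. apply HR; [| | | | lra].
  - intros v. apply continuity_pt_minus; [apply continuity_pt_plus | reg].
    + apply (continuity_pt_comp lo g1); auto.
    + apply (continuity_pt_comp hi k1); auto.
  - intros v. apply continuity_pt_minus; [apply continuity_pt_plus | reg].
    + apply (continuity_pt_comp lo g2); auto.
    + apply (continuity_pt_comp hi k2); auto.
  - destruct (F1 0) as [-> ->]; [lra |]. now rewrite Rmult_0_r.
  - intros v Hv. destruct (Rle_lt_dec v (1 / 2)) as [h | h].
    + destruct (F1 v h) as [-> ->]. apply Hg. lra.
    + destruct (F2 v) as [-> ->]; [lra |]. apply Hk. lra.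
Qed.

Lemma inside_segment (a1 a2 : R -> R) (p1 p2 q1 q2 : R) :
  inside a1 a2 (p1, p2) ->
  (forall u, 0 <= u <= 1 -> ~ onC a1 a2 (p1 + u * (q1 - p1), p2 + u * (q2 - p2))) ->
  inside a1 a2 (q1, q2).
Proof.
  intros Hp Hu.
  replace q1 with (p1 + 1 * (q1 - p1)) by ring.
  replace q2 with (p2 + 1 * (q2 - p2)) by ring.
  apply (inside_path a1 a2 (fun u => p1 + u * (q1 - p1)) (fun u => p2 + u * (q2 - p2))).
  - intros u. reg.
  - intros u. reg.
  - now rewrite !Rmult_0_l, !Rplus_0_r.
  - exact Hu.
Qed.

Lemma below_not_inside (a1 a2 : R -> R) (p1 p2 : R) :
  (forall s, p2 < a2 s) -> ~ inside a1 a2 (p1, p2).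
Proof.
  intros Hp [_ [Rb HR]].
  (* A descent by [T] ends below height [- |Rb|], outside every disc allowed by the bound. *)
  set (T := Rabs p2 + Rabs Rb + 1).
  assert (Z1 := Rabs_pos p2). assert (Z2 := Rabs_pos Rb). assert (Z3 := Rle_abs p2).
  assert (H : p1 ^ 2 + (p2 - 1 * T) ^ 2 <= Rb ^ 2).
  { apply (HR (fun _ => p1) (fun u => p2 - u * T)).
    - intros u. reg.
    - intros u. reg.
    - now rewrite Rmult_0_l, Rminus_0_r.
    - intros u Hu [s E]. injection E as _ E. specialize (Hp s). unfold T in E. nra.
    - lra. }
  rewrite <- (pow2_abs Rb) in H. assert (Z4 := pow2_ge_0 p1).
  unfold T in H. nra.
Qed.

(** Such a point escapes: along the normal into the tube, along the right-hand parallel curve to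
    below the lowest point, then straight down. *)
Lemma right_side_not_inside L a1 a2 b1 b2 c1 c2 (s0 s D : R) :
  unit_speed_curve L a1 a2 b1 b2 c1 c2 ->
  (forall s, a2 s0 <= a2 s) -> b1 s0 = 1 -> D < 0 ->
  far a1 a2 (a1 s - D * b2 s) (a2 s + D * b1 s) D ->
  ~ inside a1 a2 (a1 s - D * b2 s, a2 s + D * b1 s).
Proof.
  intros C Hmin Hb1 HD Hf Hin.
  destruct (tube_exists _ _ _ _ _ _ _ C) as [rho [Hrho T]].
  set (r := - Rmin rho (- D)).
  assert (Hr0 : r < 0) by (unfold r; assert (0 < Rmin rho (- D)) by (apply Rmin_pos; lra); lra).
  assert (Hr1 : - rho <= r) by (unfold r; assert (Z := Rmin_l rho (- D)); lra).
  assert (Hr2 : D <= r) by (unfold r; assert (Z := Rmin_r rho (- D)); lra).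
  assert (I1 : inside a1 a2 (a1 s - r * b2 s, a2 s + r * b1 s)).
  { apply (inside_segment _ _ _ _ _ _ Hin). intros u Hu.
    set (v := D + u * (r - D)).
    replace (a1 s - D * b2 s + u * (a1 s - r * b2 s - (a1 s - D * b2 s))) with (a1 s - v * b2 s)
      by (unfold v; ring).
    replace (a2 s + D * b1 s + u * (a2 s + r * b1 s - (a2 s + D * b1 s))) with (a2 s + v * b1 s)
      by (unfold v; ring).
    assert (Hv : D <= v <= r) by (unfold v; nra).
    apply (far_not_onC a1 a2 _ _ v); [lra |].
    apply (far_normal_segment _ _ _ _ _ _ _ C s D v Hf). lra. }
  set (q := fun u => s + u * (s0 - s)).
  assert (Cq : forall u, continuity_pt q u) by (intros u; unfold q; reg).
  assert (Cn : forall f df, (forall s, is_derive f s (df s)) -> forall u, continuity_pt (fun u => f (q u)) u).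
  { intros f df Hd u. apply (continuity_pt_comp q f); [apply Cq |].
    eapply is_derive_continuity_pt, Hd. }
  assert (I2 : inside a1 a2 (a1 s0 - r * b2 s0, a2 s0 + r * b1 s0)).
  { assert (E1 : q 1 = s0) by (unfold q; ring). assert (E0 : q 0 = s) by (unfold q; ring).
    rewrite <- E1.
    apply (inside_path a1 a2 (fun u => a1 (q u) - r * b2 (q u)) (fun u => a2 (q u) + r * b1 (q u))).
    - intros u. apply continuity_pt_minus; [apply (Cn a1 b1), (usc_a1 _ _ _ _ _ _ _ C) |].
      apply continuity_pt_scal. apply (Cn b2 c2), (usc_b2 _ _ _ _ _ _ _ C).
    - intros u. apply continuity_pt_plus; [apply (Cn a2 b2), (usc_a2 _ _ _ _ _ _ _ C) |].
      apply continuity_pt_scal. apply (Cn b1 c1), (usc_b1 _ _ _ _ _ _ _ C).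
    - now rewrite E0.
    - intros u _. apply (far_not_onC a1 a2 _ _ r); [lra |].
      apply T. rewrite Rabs_left; lra. }
  revert I2. apply below_not_inside. intros s'. rewrite Hb1. specialize (Hmin s'). lra.
Qed.

(** The orientation decides the sign: the tangent at a lowest point is horizontal, and pointing left
    it would put the left side below the whole curve, where nothing is enclosed. *)
Lemma lowest_point L a1 a2 b1 b2 c1 c2 :
  unit_speed_curve L a1 a2 b1 b2 c1 c2 ->
  (forall s, exists del, 0 < del /\ forall e, 0 < e < del ->
     inside a1 a2 (a1 s - e * b2 s, a2 s + e * b1 s)) ->
  exists s0, (forall s, a2 s0 <= a2 s) /\ b1 s0 = 1.
Proof.
  intros C Hleft.
  destruct (periodic_min a2 L) as [s0 Hs0].
  - apply (usc_L _ _ _ _ _ _ _ C).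
  - apply (usc_a2L _ _ _ _ _ _ _ C).
  - intros s. exact (is_derive_continuity_pt _ _ _ (usc_a2 _ _ _ _ _ _ _ C s)).
  - exists s0. split; [exact Hs0 |].
    assert (E := is_derive_min a2 s0 _ (usc_a2 _ _ _ _ _ _ _ C s0) Hs0).
    assert (U := usc_unit _ _ _ _ _ _ _ C s0). rewrite E in U.
    assert (F : (b1 s0 - 1) * (b1 s0 + 1) = 0) by lra.
    destruct (Rmult_integral _ _ F) as [h | h]; [lra | exfalso].
    destruct (Hleft s0) as [del [Hdel Hin]].
    specialize (Hin (del / 2) ltac:(lra)). revert Hin. apply below_not_inside.
    intros s. specialize (Hs0 s). replace (b1 s0) with (-1) by lra. lra.
Qed.

Lemma inside_nearest_left L a1 a2 b1 b2 c1 c2 (s0 p1 p2 : R) :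
  unit_speed_curve L a1 a2 b1 b2 c1 c2 ->
  (forall s, a2 s0 <= a2 s) -> b1 s0 = 1 -> inside a1 a2 (p1, p2) ->
  exists s D, 0 < D /\ p1 = a1 s - D * b2 s /\ p2 = a2 s + D * b1 s /\ far a1 a2 p1 p2 D.
Proof.
  intros C Hmin Hb1 Hin.
  destruct (nearest_point _ _ _ _ _ _ _ p1 p2 C) as (s & D & E1 & E2 & Hf).
  exists s, D. repeat split; auto.
  destruct (Rtotal_order D 0) as [h | [h | h]]; [| | exact h]; exfalso.
  - rewrite E1, E2 in Hin, Hf. revert Hin.
    now apply (right_side_not_inside L a1 a2 b1 b2 c1 c2 s0).
  - apply (proj1 Hin). exists s. subst D. f_equal; lra.
Qed.

(* Half-open intervals, so that rectangles with disjoint interiors have disjoint indicators. *)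
Definition chi (x0 x1 x : R) : R :=
  if Rle_dec x0 x then if Rlt_dec x x1 then 1 else 0 else 0.

Lemma chi_cases (x0 x1 x : R) : chi x0 x1 x = 0 \/ (chi x0 x1 x = 1 /\ x0 <= x < x1).
Proof.
  unfold chi. destruct (Rle_dec x0 x); [destruct (Rlt_dec x x1) |]; auto.
Qed.

Lemma is_RInt_chi (x0 x1 M : R) : - M <= x0 -> x0 <= x1 -> x1 <= M ->
  is_RInt (chi x0 x1) (- M) M (x1 - x0).
Proof.
  intros h0 h1 h2.
  assert (K : forall c u v, u <= v -> (forall x, u < x < v -> chi x0 x1 x = c) ->
            is_RInt (chi x0 x1) u v ((v - u) * c)).
  { intros c u v huv H. apply (is_RInt_ext (fun _ => c)).
    - intros x. rewrite Rmin_left, Rmax_right by lra. intros hx. symmetry. now apply H.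
    - apply (is_RInt_const u v c). }
  replace (x1 - x0) with ((x0 - - M) * 0 + ((x1 - x0) * 1 + (M - x1) * 0)) by ring.
  apply (is_RInt_Chasles (chi x0 x1) (- M) x0 M); [| apply (is_RInt_Chasles (chi x0 x1) x0 x1 M)];
    apply K; try lra; intros x hx; unfold chi;
    destruct (Rle_dec x0 x); try destruct (Rlt_dec x x1); lra.
Qed.

Definition rect_chi (r : rect) (p1 p2 : R) : R :=
  let '(x0, x1, y0, y1) := r in chi x0 x1 p1 * chi y0 y1 p2.

Definition in_rect (r : rect) (p1 p2 : R) : Prop :=
  let '(x0, x1, y0, y1) := r in x0 <= p1 <= x1 /\ y0 <= p2 <= y1.

Definition rects_chi (rs : list rect) (p1 p2 : R) : R :=
  fold_right (fun r acc => rect_chi r p1 p2 + acc) 0 rs.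

Lemma rect_chi_cases (r : rect) (p1 p2 : R) :
  rect_chi r p1 p2 = 0 \/ (rect_chi r p1 p2 = 1 /\ in_rect r p1 p2).
Proof.
  destruct r as [[[x0 x1] y0] y1]. simpl.
  destruct (chi_cases x0 x1 p1) as [-> | [-> h1]]; [left; ring |].
  destruct (chi_cases y0 y1 p2) as [-> | [-> h2]]; [left; ring | right; lra].
Qed.

Lemma rects_chi_disj (r : rect) (rs : list rect) (p1 p2 : R) :
  List.Forall (rect_disj r) rs -> rect_chi r p1 p2 = 1 -> rects_chi rs p1 p2 = 0.
Proof.
  intros H Hr. induction H as [| r' rs Hd _ IH]; [reflexivity |].
  simpl. rewrite IH, Rplus_0_r.
  destruct r as [[[x0 x1] y0] y1], r' as [[[x0' x1'] y0'] y1']. simpl in *.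
  destruct (chi_cases x0 x1 p1) as [E | [_ k1]]; [rewrite E in Hr; lra |].
  destruct (chi_cases y0 y1 p2) as [E | [_ k2]]; [rewrite E in Hr; lra |].
  destruct (chi_cases x0' x1' p1) as [-> | [_ k1']]; [ring |].
  destruct (chi_cases y0' y1' p2) as [-> | [_ k2']]; [ring |].
  destruct Hd as [h | [h | [h | h]]]; lra.
Qed.

Lemma rects_chi_cases (rs : list rect) (p1 p2 : R) : rects_disj rs ->
  rects_chi rs p1 p2 = 0 \/ (rects_chi rs p1 p2 = 1 /\ exists r, In r rs /\ in_rect r p1 p2).
Proof.
  induction rs as [| r rs IH]; intros H; [now left |].
  destruct H as [Hd H]. simpl.
  destruct (rect_chi_cases r p1 p2) as [E | [E Hin]].
  - rewrite E, Rplus_0_l. destruct (IH H) as [h | [h (r' & h1 & h2)]]; [now left | right].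
    split; [exact h |]. exists r'. auto.
  - right. rewrite (rects_chi_disj r rs p1 p2 Hd E), E. split; [ring |]. exists r. auto.
Qed.

Definition rect_in_square (M : R) (r : rect) : Prop :=
  let '(x0, x1, y0, y1) := r in - M <= x0 /\ x0 <= x1 /\ x1 <= M /\ - M <= y0 /\ y0 <= y1 /\ y1 <= M.

Lemma is_RInt_zero (a b : R) : is_RInt (fun _ => 0) a b 0.
Proof.
  evar_last; [apply is_RInt_const |]. unfold scal; simpl; unfold mult; simpl; ring.
Qed.

(** The iterated form matches [winding_integral], so a pointwise inequality can be integrated in
    [p2] and then in [p1]. *)
Lemma rects_chi_integral (rs : list rect) (M : R) : List.Forall (rect_in_square M) rs ->
  exists T : R -> R,
    (forall p1, is_RInt (fun p2 => rects_chi rs p1 p2) (- M) M (T p1)) /\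
    is_RInt T (- M) M (fold_right (fun q acc => rect_area q + acc) 0 rs).
Proof.
  induction 1 as [| r rs Hr _ [T [T1 T2]]].
  - exists (fun _ => 0). split; [intros p1 |]; apply is_RInt_zero.
  - destruct r as [[[x0 x1] y0] y1]. simpl in Hr.
    exists (fun p1 => (y1 - y0) * chi x0 x1 p1 + T p1). split.
    + intros p1. rewrite (Rmult_comm (y1 - y0)).
      apply (is_RInt_plus (fun p2 => chi x0 x1 p1 * chi y0 y1 p2)); [| apply T1].
      apply (is_RInt_scal (chi y0 y1)), is_RInt_chi; lra.
    + simpl. rewrite (Rmult_comm (x1 - x0)).
      apply (is_RInt_plus (fun p1 => (y1 - y0) * chi x0 x1 p1)); [| exact T2].
      apply (is_RInt_scal (chi x0 x1)), is_RInt_chi; lra.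
Qed.

Lemma rects_in_square (Om : R * R -> Prop) (rs : list rect) (M0 : R) :
  List.Forall (rect_ok Om) rs -> exists M, M0 <= M /\ List.Forall (rect_in_square M) rs.
Proof.
  induction 1 as [| r rs Hr _ [M [HM HF]]].
  - exists M0. split; [lra | constructor].
  - destruct r as [[[x0 x1] y0] y1]. simpl in Hr.
    set (M' := Rabs M + Rabs x0 + Rabs x1 + Rabs y0 + Rabs y1).
    assert (K : forall x, - Rabs x <= x <= Rabs x).
    { intros x. assert (Z1 := Rle_abs x). assert (Z2 := Rle_abs (- x)).
      rewrite Rabs_Ropp in Z2. lra. }
    assert (KM := K M). assert (K1 := K x0). assert (K2 := K x1).
    assert (K3 := K y0). assert (K4 := K y1).
    assert (HMM : M <= M') by (unfold M'; lra).
    exists M'. split; [lra |]. constructor.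
    + simpl. unfold M'. lra.
    + eapply List.Forall_impl; [| exact HF]. intros [[[u0 u1] v0] v1]. simpl. lra.
Qed.

(* [Rabs (x - x0) + Rabs (x - x1) - (x1 - x0)] is twice the distance from [x] to [[x0, x1]]. *)
Lemma rect_far L a1 a2 b1 b2 c1 c2 (r : rect) :
  unit_speed_curve L a1 a2 b1 b2 c1 c2 -> rect_ok (inside a1 a2) r ->
  exists eta, 0 < eta /\ forall p1 p2, in_rect r p1 p2 -> far a1 a2 p1 p2 eta.
Proof.
  intros C. destruct r as [[[x0 x1] y0] y1]. simpl. intros (Hx & Hy & Hin).
  set (q := fun u v x => Rabs (x - u) + Rabs (x - v) - (v - u)).
  set (F := fun s => q x0 x1 (a1 s) + q y0 y1 (a2 s)).
  assert (Cq : forall u v x, continuity_pt (q u v) x).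
  { intros u v x. unfold q. apply continuity_pt_minus; [apply continuity_pt_plus | reg];
      apply (continuity_pt_comp (fun x => x - _) Rabs); try reg; apply Rcontinuity_abs. }
  assert (Hq : forall u v x y, u <= y <= v -> q u v x <= 2 * Rabs (x - y)).
  { intros u v x y h. unfold q, Rabs. repeat destruct (Rcase_abs _); lra. }
  assert (Hq0 : forall u v x, u < v -> 0 <= q u v x /\ (q u v x <= 0 -> u <= x <= v)).
  { intros u v x h. unfold q, Rabs. repeat destruct (Rcase_abs _); split; intros; lra. }
  destruct (periodic_min F L) as [s0 Hs0].
  - apply (usc_L _ _ _ _ _ _ _ C).
  - intros s. unfold F. now rewrite (usc_a1L _ _ _ _ _ _ _ C), (usc_a2L _ _ _ _ _ _ _ C).
  - intros s. unfold F. apply continuity_pt_plus.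
    + apply (continuity_pt_comp a1 (q x0 x1)); [| apply Cq].
      exact (is_derive_continuity_pt _ _ _ (usc_a1 _ _ _ _ _ _ _ C s)).
    + apply (continuity_pt_comp a2 (q y0 y1)); [| apply Cq].
      exact (is_derive_continuity_pt _ _ _ (usc_a2 _ _ _ _ _ _ _ C s)).
  - assert (HF : 0 < F s0).
    { destruct (Hq0 x0 x1 (a1 s0) Hx) as [Z1 Z2]. destruct (Hq0 y0 y1 (a2 s0) Hy) as [Z3 Z4].
      destruct (Rle_lt_dec (F s0) 0) as [h | h]; [exfalso | exact h]. unfold F in h.
      apply (proj1 (Hin (a1 s0) (a2 s0) (Z2 ltac:(lra)) (Z4 ltac:(lra)))). now exists s0. }
    (* [F] is at most twice the sum of the coordinate distances [X] and [Y], so [X^2 + Y^2 >= (X +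
       Y)^2 / 2 >= (F s0)^2 / 8]. *)
    exists (F s0 / 4). split; [lra |]. intros p1 p2 [h1 h2] s. specialize (Hs0 s).
    assert (V1 := Hq x0 x1 (a1 s) p1 h1). assert (V2 := Hq y0 y1 (a2 s) p2 h2).
    assert (V : F s0 <= 2 * Rabs (a1 s - p1) + 2 * Rabs (a2 s - p2)) by (unfold F in *; lra).
    rewrite <- (pow2_abs (a1 s - p1)), <- (pow2_abs (a2 s - p2)).
    set (X := Rabs (a1 s - p1)) in *. set (Y := Rabs (a2 s - p2)) in *.
    assert (Z := pow2_ge_0 (X - Y)). nra.
Qed.

Lemma rects_far L a1 a2 b1 b2 c1 c2 (rs : list rect) :
  unit_speed_curve L a1 a2 b1 b2 c1 c2 -> List.Forall (rect_ok (inside a1 a2)) rs ->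
  exists eta, 0 < eta /\ forall r p1 p2, In r rs -> in_rect r p1 p2 -> far a1 a2 p1 p2 eta.
Proof.
  intros C. induction 1 as [| r rs Hr _ [eta [He IH]]].
  - exists 1. split; [lra |]. intros r p1 p2 [].
  - destruct (rect_far _ _ _ _ _ _ _ r C Hr) as [eta' [He' Hf]].
    assert (M1 := Rmin_l eta eta'). assert (M2 := Rmin_r eta eta').
    assert (M0 : 0 < Rmin eta eta') by (apply Rmin_pos; lra).
    exists (Rmin eta eta'). split; [exact M0 |].
    intros r' p1 p2 [<- | h] Hin s.
    + specialize (Hf p1 p2 Hin s). nra.
    + specialize (IH r' p1 p2 h Hin s). nra.
Qed.

Lemma rects_area_le L a1 a2 b1 b2 c1 c2 (rs : list rect) (s0 : R) :
  unit_speed_curve L a1 a2 b1 b2 c1 c2 ->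
  (forall s, a2 s0 <= a2 s) -> b1 s0 = 1 ->
  List.Forall (rect_ok (inside a1 a2)) rs -> rects_disj rs ->
  fold_right (fun q acc => rect_area q + acc) 0 rs <= - RInt (fun s => a2 s * b1 s) 0 L.
Proof.
  intros C Hmin Hb1 Hok Hdisj.
  destruct (winding_values _ _ _ _ _ _ _ s0 C Hmin Hb1) as [d0 [Hd0 HW]].
  destruct (rects_far _ _ _ _ _ _ _ rs C Hok) as [eta [Heta Hfar]].
  (* Points of the rectangles have normal coordinate [D >= eta], and [eta >= 8 d] is what the value
     1 requires. *)
  set (d := Rmin d0 (eta / 8)).
  assert (Hd : 0 < d) by (apply Rmin_pos; lra).
  assert (Hd1 : d <= d0) by apply Rmin_l. assert (Hd2 : d <= eta / 8) by apply Rmin_r.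
  destruct (bump_exists d Hd) as (Psi2 & Psi & psi & dpsi & B).
  destruct (HW d Psi2 Psi psi dpsi ltac:(lra) B) as [W0 W1]. clear HW.
  assert (Bd : forall f df, (forall s, is_derive f s (df s)) -> (forall s, f (s + L) = f s) ->
             exists K, forall s, Rabs (f s) <= K).
  { intros f df Hf HfL.
    destruct (periodic_min (fun s => - Rabs (f s)) L) as [s1 Hs1].
    - apply (usc_L _ _ _ _ _ _ _ C).
    - intros s. now rewrite HfL.
    - intros s. apply continuity_pt_opp, (continuity_pt_comp f Rabs); [| apply Rcontinuity_abs].
      exact (is_derive_continuity_pt _ _ _ (Hf s)).
    - exists (Rabs (f s1)). intros s. specialize (Hs1 s). lra. }
  destruct (Bd a1 b1 (usc_a1 _ _ _ _ _ _ _ C) (usc_a1L _ _ _ _ _ _ _ C)) as [K1 HK1].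
  destruct (Bd a2 b2 (usc_a2 _ _ _ _ _ _ _ C) (usc_a2L _ _ _ _ _ _ _ C)) as [K2 HK2].
  destruct (rects_in_square _ rs (K1 + K2 + d) Hok) as [M [HM Hsq]].
  assert (M1 : forall s, Rabs (a1 s) + d <= M).
  { intros s. specialize (HK1 s). specialize (HK2 s). assert (Z := Rabs_pos (a2 s)). lra. }
  assert (M2 : forall s, Rabs (a2 s) + d <= M).
  { intros s. specialize (HK1 s). specialize (HK2 s). assert (Z := Rabs_pos (a1 s)). lra. }
  assert (HMpos : - M <= M) by (specialize (M1 0); assert (Z := Rabs_pos (a1 0)); lra).
  destruct (winding_integral L a1 a2 b1 b2 c1 c2 d Psi2 Psi psi dpsi M C B M1 M2) as [V [V1 V2]].
  destruct (rects_chi_integral rs M Hsq) as [T [T1 T2]].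
  apply (is_RInt_le T V (- M) M _ _ HMpos T2 V2). intros p1 _.
  apply (is_RInt_le _ _ (- M) M _ _ HMpos (T1 p1) (V1 p1)). intros p2 _.
  destruct (rects_chi_cases rs p1 p2 Hdisj) as [-> | [-> (r & Hr & Hin)]]; [apply W0 |].
  assert (Hp : inside a1 a2 (p1, p2)).
  { rewrite List.Forall_forall in Hok. specialize (Hok r Hr).
    destruct r as [[[x0 x1] y0] y1]. simpl in Hok, Hin. now apply Hok. }
  assert (Hf := Hfar r p1 p2 Hr Hin).
  destruct (inside_nearest_left _ _ _ _ _ _ _ s0 p1 p2 C Hmin Hb1 Hp) as (s & D & HD & E1 & E2 & HfD).
  assert (HeD : eta <= D).
  { specialize (Hf s). rewrite E1, E2 in Hf.
    replace ((a1 s - (a1 s - D * b2 s)) ^ 2 + (a2 s - (a2 s + D * b1 s)) ^ 2)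
      with (D ^ 2 * (b1 s ^ 2 + b2 s ^ 2)) in Hf by ring.
    rewrite (usc_unit _ _ _ _ _ _ _ C) in Hf. nra. }
  subst p1 p2. rewrite W1; [lra | lra | exact HfD].
Qed.

Lemma inside_contains_rect L a1 a2 b1 b2 c1 c2 (p1 p2 : R) :
  unit_speed_curve L a1 a2 b1 b2 c1 c2 -> inside a1 a2 (p1, p2) ->
  exists r, rect_ok (inside a1 a2) r /\ 0 < rect_area r.
Proof.
  intros C Hin.
  destruct (nearest_point _ _ _ _ _ _ _ p1 p2 C) as (s & D & E1 & E2 & Hf).
  assert (HD : D <> 0).
  { intros ->. apply (proj1 Hin). exists s. f_equal; lra. }
  (* The square of half-side [h] lies well inside the disc of radius [|D|] about [p], which the
     curve does not enter, so straight segments connect its points to [p]. *)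
  apply Rabs_pos_lt in HD. set (h := Rabs D / 4).
  exists (p1 - h, p1 + h, p2 - h, p2 + h). simpl.
  assert (Hh : 0 < h) by (unfold h; lra).
  split; [split; [lra | split; [lra |]] | nra].
  intros x y Hx Hy. apply (inside_segment _ _ _ _ _ _ Hin).
  intros u Hu [s' E]. injection E as X1 X2. specialize (Hf s').
  rewrite <- X1, <- X2, <- (pow2_abs D) in Hf.
  replace (Rabs D) with (4 * h) in Hf by (unfold h; field).
  replace (p1 + u * (x - p1) - p1) with (u * (x - p1)) in Hf by ring.
  replace (p2 + u * (y - p2) - p2) with (u * (y - p2)) in Hf by ring.
  assert (Y1 : - h <= u * (x - p1) <= h) by nra.
  assert (Y2 : - h <= u * (y - p2) <= h) by nra.
  nra.
Qed.

(** * The height bound *)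

Theorem theorem1 (a1 a2 : R -> R) (L l a b A : R) :
  0 < L -> 0 < l ->
  smooth a1 -> smooth a2 ->
  (* L-periodic *)
  (forall s, a1 (s + L) = a1 s /\ a2 (s + L) = a2 s) ->
  (* arc-length parametrized *)
  (forall s, Der a1 s ^ 2 + Der a2 s ^ 2 = 1) ->
  (* the trace is a simple closed curve (of length L) *)
  (forall s s', 0 <= s < L -> 0 <= s' < L ->
     a1 s = a1 s' -> a2 s = a2 s' -> s = s') ->
  (* traversed counterclockwise: the enclosed domain lies to the left,
     i.e. on the side of n = J alpha' *)
  (forall s, exists del, 0 < del /\ forall e, 0 < e < del ->
     inside a1 a2 (a1 s - e * Der a2 s, a2 s + e * Der a1 s)) ->
  (* A = |Omega| *)
  is_area (inside a1 a2) A ->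
  (* rotating stationary: 2H = a (x1^2 + x2^2) + b on M *)
  (forall t s, 0 <= t <= l ->
     twoH a1 a2 t s = a * (vx (xM a1 a2 t s) ^ 2 + vy (xM a1 a2 t s) ^ 2) + b) ->
  0 < a ->
  stable a1 a2 L l a ->
  l <= PI / 2 * sqrt (L / (a * A)).
Proof.
  intros HL Hl H1 H2 Hper Hunit Hinj Hleft [Hub Hlub] _ Ha Hst.
  assert (C : unit_speed_curve L a1 a2 (Der a1) (Der a2) (nDer 2 a1) (nDer 2 a2)).
  { split; auto.
    - intros s. apply Hper.
    - intros s. apply Hper.
    - intros s. exact (smooth_is_derive a1 0 s H1).
    - intros s. exact (smooth_is_derive a2 0 s H2).
    - intros s. exact (smooth_is_derive a1 1 s H1).
    - intros s. exact (smooth_is_derive a2 1 s H2).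
    - intros s. exact (is_derive_continuous _ _ _ (smooth_is_derive a1 2 s H1)).
    - intros s. exact (is_derive_continuous _ _ _ (smooth_is_derive a2 2 s H2)). }
  set (b1 := Der a1) in *. set (b2 := Der a2) in *.
  destruct (lowest_point _ _ _ _ _ _ _ C Hleft) as (s0 & Hmin & Hb1).
  (* Green's expression [- int y dx] for the enclosed area. *)
  set (I := - RInt (fun s => a2 s * b1 s) 0 L).
  assert (HAI : A <= I).
  { apply Hlub. intros x (rs & Hok & Hd & ->).
    exact (rects_area_le _ _ _ _ _ _ _ rs s0 C Hmin Hb1 Hok Hd). }
  (* Positivity is what allows the denominator [a * A] to be cleared. *)
  assert (HA : 0 < A).
  { destruct (Hleft 0) as [del [Hdel Hin]].
    destruct (inside_contains_rect _ _ _ _ _ _ _ _ _ C (Hin (del / 2) ltac:(lra))) as [r [Hr Hpos]].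
    apply Rlt_le_trans with (1 := Hpos). apply Hub.
    exists (r :: nil). repeat split; auto. simpl. ring. }
  (* The integral of [(a1 a2)'] over a period vanishes, so the two halves of the symmetric area form
     agree. *)
  assert (HW : RInt (fun s => a1 s * b2 s - a2 s * b1 s) 0 L = 2 * I).
  { assert (C1 : forall s, continuous a1 s)
      by exact (fun s => is_derive_continuous _ _ _ (usc_a1 _ _ _ _ _ _ _ C s)).
    assert (C2 : forall s, continuous a2 s)
      by exact (fun s => is_derive_continuous _ _ _ (usc_a2 _ _ _ _ _ _ _ C s)).
    assert (C3 : forall s, continuous b1 s)
      by exact (fun s => is_derive_continuous _ _ _ (usc_b1 _ _ _ _ _ _ _ C s)).
    assert (C4 : forall s, continuous b2 s)
      by exact (fun s => is_derive_continuous _ _ _ (usc_b2 _ _ _ _ _ _ _ C s)).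
    assert (I0 : is_RInt (fun s => b1 s * a2 s + a1 s * b2 s) 0 L 0).
    { apply (is_RInt_periodic_derive (fun s => a1 s * a2 s)).
      - intros s. exact (is_derive_prod _ _ _ _ _ (usc_a1 _ _ _ _ _ _ _ C s) (usc_a2 _ _ _ _ _ _ _ C s)).
      - intros s. apply (continuous_plus (fun s => b1 s * a2 s) (fun s => a1 s * b2 s)).
        + apply (continuous_mult b1 a2); auto.
        + apply (continuous_mult a1 b2); auto.
      - replace L with (0 + L) by ring.
        now rewrite (usc_a1L _ _ _ _ _ _ _ C), (usc_a2L _ _ _ _ _ _ _ C). }
    assert (I1 : is_RInt (fun s => a2 s * b1 s) 0 L (- I)).
    { unfold I. rewrite Ropp_involutive. apply (RInt_correct (fun s => a2 s * b1 s)).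
      apply (ex_RInt_continuous (fun s => a2 s * b1 s)). intros s _.
      apply (continuous_mult a2 b1); auto. }
    apply is_RInt_unique.
    replace (2 * I) with (0 - 2 * - I) by ring.
    apply (is_RInt_ext (fun s => (b1 s * a2 s + a1 s * b2 s) - 2 * (a2 s * b1 s))).
    - intros s _. change (b1 s * a2 s + a1 s * b2 s - 2 * (a2 s * b1 s) = a1 s * b2 s - a2 s * b1 s). ring.
    - exact (is_RInt_minus _ _ 0 L _ _ I0 (is_RInt_scal _ 0 L 2 _ I1)). }
  (* With [HW] the bound reads [4 a I <= (PI / l)^2 L], and [A <= I] turns it into the claim
     squared. *)
  assert (HB := stable_height_bound a1 a2 L l a HL Hl H1 H2 Hper Hunit Hst).
  fold b1 b2 in HB. rewrite HW in HB.
  assert (HaA : 0 < a * A) by (apply Rmult_lt_0_compat; lra).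
  assert (HP := PI_RGT_0).
  assert (Hq : 0 <= L / (a * A)) by (apply Rlt_le, Rdiv_lt_0_compat; lra).
  assert (Hsq : 0 <= sqrt (L / (a * A))) by apply sqrt_pos.
  apply Rsqr_incr_0; [| lra | apply Rmult_le_pos; lra].
  rewrite Rsqr_mult, (Rsqr_sqrt _ Hq). unfold Rsqr.
  replace (PI / 2 * (PI / 2) * (L / (a * A))) with (PI ^ 2 * L / (4 * (a * A))) by (field; lra).
  apply (Rle_div_r (l * l) (PI ^ 2 * L)); [lra |].
  replace ((PI / l) ^ 2 * L) with (PI ^ 2 * L / l ^ 2) in HB by (field; lra).
  apply Rle_div_r in HB; [| nra].
  assert (a * A <= a * I) by (apply Rmult_le_compat_l; lra).
  assert (a * A * l ^ 2 <= a * I * l ^ 2) by (apply Rmult_le_compat_r; nra).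
  nra.
Qed.
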